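(* Let $1<s<\infty$, let $f\in X_s(\mathbb{R}^n)$ and let $s<r\le\infty$. Then $f$ belongs to the Hardy–Lorentz space $H^{1,r}(\mathbb{R}^n)$, and $$\|f\|_{H^{1,r}}\le c_r\,\|f\|_{X_s},$$ where $c_r$ is a constant independent of $f$ with $c_r=O\big(c/(1/s-1/r)\big)$, $c$ being a constant independent of $f$ and $r$.
   Context: For $1<q\le 2$ with conjugate exponent $2\le p<\infty$, $1/p+1/q=1$, and $0<s\le\infty$ (with $1/\infty=0$), a compactly supported function $a$ on $\mathbb{R}^n$ is a $(q,s)$ atom with defining cube $Q$ if $\mathrm{supp}(a)\subseteq Q$, $\int_Q a(x)\,dx=0$, and $$p^{1/s}\,|Q|\left(\frac1{|Q|}\int_Q|a(x)|^q\,dx\right)^{1/q}\le 1 .$$ $\mathcal{A}_s$ denotes the collection of all $(q,s)$ atoms, over all $1<q\le 2$ and all cubes $Q$; it is contained in the unit ball of $L^1(\mathbb{R}^n)$. The space $X_s=X_s(\mathbb{R}^n)$ consists of all $f\in L^1(\mathbb{R}^n)$ of the form $f=\sum_j\lambda_j a_j$ (convergence in $L^1$) with $a_j\in\mathcal{A}_s$ and $\sum_j|\lambda_j|<\infty$, normed by $\|f\|_{X_s}=\inf\sum_j|\lambda_j|$, the infimum being over all such decompositions of $f$. $L^{1,r}$ is the Lorentz space on $\mathbb{R}^n$, with $\|g\|_{1,r}=\big(\int_0^\infty (t\,g^*(t))^r\,dt/t\big)^{1/r}$ for $r<\infty$ and $\|g\|_{1,\infty}=\sup_{t>0}t\,g^*(t)$,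 $g^*$ being the decreasing rearrangement of $g$. The Hardy–Lorentz space $H^{1,r}$ consists of those distributions $f$ whose non-tangential maximal function $Nf$ is in $L^{1,r}$, with $\|f\|_{H^{1,r}}=\|Nf\|_{1,r}$. Here $Nf(x)=\sup_{|x-y|<t}|(f*\phi_t)(y)|$, where $\phi$ is a fixed Schwartz function with $\int\phi\neq 0$ and $\phi_t(y)=t^{-n}\phi(y/t)$. *)

(* Defs.v *)
From HB Require Import structures.
From mathcomp Require Import all_boot all_order all_algebra.
From mathcomp Require Import all_classical all_reals all_analysis.
From mathcomp Require Import measurable_realfun.

Set Implicit Arguments.
Unset Strict Implicit.
Unset Printing Implicit Defensive.

Import Order.TTheory GRing.Theory Num.Def Num.Theory.
Import numFieldNormedType.Exports.

Local Open Scope classical_set_scope.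
Local Open Scope ring_scope.

(* The sigma-algebra generated by the coordinates: for T = R it is the Borel
   sigma-algebra of R^n. *)
Section measurable_rV.
Context {d : measure_display} {T : measurableType d}.
Variable n : nat.

Let coors : 'I_n -> 'rV[T]_n -> T := fun i x => x 0 i.

Let rV_set0 : g_sigma_preimage coors set0.
Proof. exact: sigma_algebra0. Qed.

Let rV_setC A : g_sigma_preimage coors A -> g_sigma_preimage coors (~` A).
Proof. exact: sigma_algebraC. Qed.

Let rV_bigcup (F : _^nat) : (forall i, g_sigma_preimage coors (F i)) ->
  g_sigma_preimage coors (\bigcup_i (F i)).
Proof. exact: sigma_algebra_bigcup. Qed.

HB.instance Definition _ := @isMeasurable.Build (measure_tuple_display d)
  'rV[T]_n (g_sigma_preimage coors) rV_set0 rV_setC rV_bigcup.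

End measurable_rV.

Section measurable_rV_lemmas.
Context {d d' : measure_display}.

Lemma measurable_rV_coord (T : measurableType d) n (i : 'I_n) :
  measurable_fun [set: 'rV[T]_n] (fun x => x 0 i).
Proof.
move=> _ Y mY; rewrite setTI; apply: sub_sigma_algebra => /=.
rewrite -bigcup_seq/=; exists i => /=; first by rewrite mem_index_enum.
by exists Y => //; rewrite setTI.
Qed.

Lemma measurable_fun_rV (T' : measurableType d') (T : measurableType d) n
    (f : T' -> 'rV[T]_n) :
  (forall i, measurable_fun [set: T'] (fun x => f x 0 i)) ->
  measurable_fun [set: T'] f.
Proof.
move=> mf.
have sub : g_sigma_preimage (fun i => (fun x : 'rV[T]_n => x 0 i) \o f)
    `<=` measurable.
  apply: smallest_sub; first exact: sigma_algebra_measurable.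
  rewrite -bigcup_seq; apply: bigcup_sub => i _.
  by move=> A [B mB <-]; exact: mf.
rewrite g_sigma_preimage_comp in sub.
by move=> _ A mA; apply: sub; exists A.
Qed.

End measurable_rV_lemmas.

Section lebesgue_measure_rV.
Context {R : realType}.

Definition rV_cons n (tx : R * 'rV[R]_n) : 'rV[R]_n.+1 :=
  \row_i oapp (fun j => tx.2 0 j) tx.1 (unlift ord0 i).

Definition rV_uncons n (x : 'rV[R]_n.+1) : R * 'rV[R]_n :=
  (x 0 ord0, \row_j x 0 (lift ord0 j)).

Lemma rV_consK n : cancel (@rV_cons n) (@rV_uncons n).
Proof.
move=> [t x]; rewrite /rV_uncons /rV_cons !mxE unlift_none /=.
by congr pair; apply/rowP => j; rewrite !mxE liftK.
Qed.

Lemma rV_unconsK n : cancel (@rV_uncons n) (@rV_cons n).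
Proof.
move=> x; apply/rowP => i; rewrite !mxE.
by case: unliftP => [j ->|->] //=; rewrite mxE.
Qed.

Lemma measurable_rV_cons n : measurable_fun setT (@rV_cons n).
Proof.
apply: measurable_fun_rV => i; rewrite /rV_cons.
case: (unliftP ord0 i) => [j|] ->.
  under eq_fun do rewrite mxE liftK /=.
  exact: (measurableT_comp (measurable_rV_coord j) measurable_snd).
under eq_fun do rewrite mxE unlift_none /=.
exact: measurable_fst.
Qed.

Lemma measurable_rV_uncons n : measurable_fun setT (@rV_uncons n).
Proof.
apply/measurable_fun_pairP; split; first exact: (measurable_rV_coord ord0).
apply: measurable_fun_rV => i /=.
under eq_fun do rewrite mxE.
exact: measurable_rV_coord.
Qed.

Section step.
Variables (n : nat) (m : {sigma_finite_measure set 'rV[R]_n -> \bar R}).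

Let lebesgue1 : {sigma_finite_measure set (measurableTypeR R) -> \bar R} :=
  @lebesgue_measure R.

Definition lebesgue_rV_step : set 'rV[R]_n.+1 -> \bar R :=
  pushforward (lebesgue1 \x m)%E (@rV_cons n).

HB.instance Definition _ := Measure.copy lebesgue_rV_step
  (measure_function_pushforward__canonical__measure_function_Measure
    (lebesgue1 \x m)%E (@measurable_rV_cons n)).

Let lebesgue_rV_step_sigma_finite : sigma_finite setT lebesgue_rV_step.
Proof.
have /sigma_finiteP[F [TF ndF Foo]] := sigma_finiteT lebesgue1.
have /sigma_finiteP[G [TG ndG Goo]] := sigma_finiteT m.
exists (fun k => @rV_uncons n @^-1` (F k `*` G k)).
  apply/esym; rewrite -subTset => x _.
  have [i _ Fi] : (\bigcup_k F k) (x 0 ord0) by rewrite -TF.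
  have [j _ Gj] : (\bigcup_k G k) (rV_uncons x).2 by rewrite -TG.
  exists (maxn i j) => //; split => /=.
    by move: Fi; exact/subsetPset/ndF/leq_maxl.
  by move: Gj; exact/subsetPset/ndG/leq_maxr.
move=> k; have [mF Fk] := Foo k; have [mG Gk] := Goo k; split.
  rewrite -[X in measurable X]setTI.
  by apply: measurable_rV_uncons => //; exact: measurableX.
rewrite /lebesgue_rV_step /pushforward -comp_preimage.
rewrite (_ : _ \o _ = id); last by apply/funext => x /=; rewrite rV_consK.
by rewrite preimage_id product_measure1E// lte_mul_pinfty// ge0_fin_numE.
Qed.

HB.instance Definition _ := Measure_isSigmaFinite.Build _ _ _ lebesgue_rV_step
  lebesgue_rV_step_sigma_finite.

End step.

Fixpoint lebesgue_rV n : {sigma_finite_measure set 'rV[R]_n -> \bar R} :=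
  if n is n'.+1 then lebesgue_rV_step (lebesgue_rV n') else \d_(0 : 'rV[R]_0).

End lebesgue_measure_rV.

Lemma lebesgue_rV_box (R : realType) n (a b : 'rV[R]_n) :
  (forall i, a 0 i <= b 0 i) ->
  lebesgue_rV n [set x | forall i, a 0 i <= x 0 i <= b 0 i] =
  (\prod_(i < n) (b 0 i - a 0 i))%:E.
Proof.
elim: n => [|n IHn] in a b *; move=> ab.
  by rewrite big_ord0 /= diracE mem_set//= => -[].
rewrite big_ord_recl /= /lebesgue_rV_step /pushforward.
set A := (X in product_measure1 _ _ X).
have {A}-> : A = `[a 0 ord0, b 0 ord0] `*`
    [set x : 'rV[R]_n | forall j, (rV_uncons a).2 0 j <= x 0 j <= (rV_uncons b).2 0 j].
  rewrite {}/A; apply/seteqP; split => -[t x] /=.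
    move=> abx; split; first by have := abx ord0; rewrite !mxE unlift_none in_itv.
    by move=> j; have := abx (lift ord0 j); rewrite !mxE liftK.
  rewrite in_itv/= => -[abt abx] i; rewrite !mxE.
  by case: (unliftP ord0 i) => [j|] ->//=; have := abx j; rewrite !mxE.
have mB : measurable
    [set x : 'rV[R]_n | forall j, (rV_uncons a).2 0 j <= x 0 j <= (rV_uncons b).2 0 j].
  rewrite [X in measurable X](_ : _ = \big[setI/setT]_(j < n)
    ((fun x : 'rV[R]_n => x 0 j) @^-1` `[a 0 (lift ord0 j), b 0 (lift ord0 j)])).
    apply: bigsetI_measurable => j _.
    by rewrite -[X in measurable X]setTI; exact: measurable_rV_coord.
  rewrite -bigcap_seq; apply/seteqP; split => x /= abx j.
    by move=> _ /=; have := abx j; rewrite !mxE in_itv.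
  by have := abx j (mem_index_enum _); rewrite /= in_itv/= !mxE.
rewrite product_measure1E// IHn; last by move=> j; rewrite !mxE.
rewrite /= lebesgue_measure_itv/= lte_fin.
under eq_bigr do rewrite !mxE.
rewrite EFinM; congr *%E.
case: ltP => // ba.
by have -> : b 0 ord0 = a 0 ord0; [apply/eqP; rewrite eq_le ba ab|rewrite subrr].
Qed.

Section definitions.
Context {R : realType} {n : nat}.
Implicit Types (f a psi phi : 'rV[R]_n -> R) (g : 'rV[R]_n -> \bar R).
Implicit Types (r s : \bar R) (Q : set 'rV[R]_n).

Local Notation mu := (@lebesgue_rV R n).

Definition cube (x0 : 'rV[R]_n) (l : R) : set 'rV[R]_n :=
  [set x | forall i, x0 0 i <= x 0 i <= x0 0 i + l].

Definition supp f : set 'rV[R]_n := closure [set x | f x != 0].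

(* The library's inverse on \bar R satisfies +oo^-1 = 0, as wanted for
   s = +oo. Cubes are closed, so that supp a `<=` Q makes supp a compact. *)
Definition is_atom_on (p q : R) s Q a : Prop :=
  [/\ measurable_fun setT a,
      supp a `<=` Q,
      (\int[mu]_(x in Q) (a x)%:E = 0)%E &
      ((p `^ fine s^-1)%:E * mu Q *
       ((mu Q)^-1 * \int[mu]_(x in Q) (`|a x| `^ q)%:E) `^ q^-1 <= 1)%E].

Definition atoms s : set ('rV[R]_n -> R) :=
  [set a | exists p q x0 l,
     [/\ 1 < q, q <= 2, p^-1 + q^-1 = 1, 0 < l &
         is_atom_on p q s (cube x0 l) a]].

Definition atomic_decomposition s f (lam : R^nat)
    (a : nat -> 'rV[R]_n -> R) : Prop :=
  [/\ forall j, atoms s (a j),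
      (\sum_(0 <= j <oo) `|lam j|%:E < +oo)%E &
      ('N[mu]_1[(fun x => (f x - \sum_(0 <= j < N) lam j * a j x)%R%:E)])%E
        @[N --> \oo] --> 0%E].

Definition Xspace s : set ('rV[R]_n -> R) :=
  [set f | mu.-integrable setT (EFin \o f) /\
     exists (lam : R^nat) (a : nat -> 'rV[R]_n -> R),
       atomic_decomposition s f lam a].

Definition Xnorm s f : \bar R :=
  ereal_inf [set N | exists (lam : R^nat) (a : nat -> 'rV[R]_n -> R),
       atomic_decomposition s f lam a /\
     N = (\sum_(0 <= j <oo) `|lam j|%:E)%E].

Definition rearrangement g (t : R) : \bar R :=
  ereal_inf [set y%:E | y in
    [set y : R | 0 <= y /\ (mu [set x | y%:E < `|g x|] <= t%:E)%E]].

Definition lorentz1_norm r g : \bar R :=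
  match r with
  | r'%:E => ((\int[lebesgue_measure]_(t in `]0%R, +oo[)
                 ((t%:E * rearrangement g t) `^ r' * (t^-1)%:E)) `^ r'^-1)%E
  | +oo%E => ereal_sup [set (t%:E * rearrangement g t)%E | t in `]0, +oo[]
  | -oo%E => 0%E
  end.

Definition lorentz1 r : set ('rV[R]_n -> \bar R) :=
  [set g | measurable_fun setT g /\ (lorentz1_norm r g < +oo)%E].

Definition partial (i : 'I_n) psi : 'rV[R]_n -> R := 'D_(delta_mx 0 i) psi.

(* Iterated partial derivatives are indexed by lists of coordinates; on
   smooth functions the order is irrelevant and they are the usual
   multi-index derivatives. *)
Definition partials (l : seq 'I_n) psi : 'rV[R]_n -> R := foldr partial psi l.

Definition monomial (al : 'I_n -> nat) (x : 'rV[R]_n) : R :=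
  \prod_(i < n) x 0 i ^+ al i.

Definition schwartz_seminorm (al : 'I_n -> nat) (l : seq 'I_n) psi : \bar R :=
  ereal_sup (range (fun x => `|monomial al x * partials l psi x|%:E)).

Definition schwartz : set ('rV[R]_n -> R) :=
  [set psi | (forall l x, differentiable (partials l psi) x) /\
     forall al l, (schwartz_seminorm al l psi < +oo)%E].

(* Only the values on Schwartz functions are meaningful. *)
Definition tempered : set (('rV[R]_n -> R) -> R) :=
  [set u |
    (forall (c : R) psi1 psi2, schwartz psi1 -> schwartz psi2 ->
       u (fun x => c * psi1 x + psi2 x) = c * u psi1 + u psi2) /\
    exists (C : R) (F : seq (('I_n -> nat) * seq 'I_n)),
      forall psi, schwartz psi ->
        (`|u psi|%:E <= C%:E * \sum_(k <- F) schwartz_seminorm k.1 k.2 psi)%E].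

Definition distribution_of f : ('rV[R]_n -> R) -> R :=
  fun psi => \int[mu]_x (f x * psi x).

Definition euclidean_norm (x : 'rV[R]_n) : R :=
  Num.sqrt (\sum_(i < n) x 0 i ^+ 2).

Definition dilate phi (t : R) : 'rV[R]_n -> R :=
  fun y => t ^- n * phi (t^-1 *: y).

Definition convolve (u : ('rV[R]_n -> R) -> R) psi : 'rV[R]_n -> R :=
  fun y => u (fun z => psi (y - z)).

Definition nontangential_max phi (u : ('rV[R]_n -> R) -> R) :
    'rV[R]_n -> \bar R :=
  fun x => ereal_sup [set `|convolve u (dilate phi yt.2) yt.1|%:E | yt in
    [set yt : 'rV[R]_n * R | euclidean_norm (x - yt.1) < yt.2]].

Definition hardy_lorentz_norm phi r (u : ('rV[R]_n -> R) -> R) : \bar R :=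
  lorentz1_norm r (nontangential_max phi u).

Definition hardy_lorentz phi r : set (('rV[R]_n -> R) -> R) :=
  [set u | tempered u /\ lorentz1 r (nontangential_max phi u)].

End definitions.

(* Main.v *)
Require Import Defs.
From HB Require Import structures.
From mathcomp Require Import all_boot all_order all_algebra.
From mathcomp Require Import all_classical all_reals all_analysis.
From mathcomp Require Import measurable_realfun.
From mathcomp Require Import lra.

Set Implicit Arguments.
Unset Strict Implicit.
Unset Printing Implicit Defensive.

Import Order.TTheory GRing.Theory Num.Def Num.Theory.
Import numFieldNormedType.Exports.

Local Open Scope classical_set_scope.
Local Open Scope ring_scope.

(** Why the theorem holds.  Two facts about an atom [a] with exponents [p], [q]
    carry the proof: its L^1 norm is at most 2 p^(-1/s), and the integral of
    its nontangential maximal function is at most C p^(1-1/s).  The second one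
    is a local estimate: on a cube comparable to the support, [N a] is
    controlled by the Hardy-Littlewood maximal function [hlmax], which is of
    weak type (q,q) with a constant independent of q, so that integrating the
    distribution function costs a geometric series of size 1/(q-1) <= p
    ([integral_hlmax_le]); far from the support, the cancellation of [a] and
    the smoothness of phi give an integrable tail
    ([integral_atom_nontangential]).

    The quasi-norms of L^{1,r} cannot be summed over a decomposition
    f = sum_j lam_j a_j, so the estimate goes through the distribution
    function of [N f].  Let L be an upper bound of sum_j |lam_j|.  For each
    P >= 1 the atoms are split according to whether p_j > P or p_j <= P.  The
    first group has total L^1 mass O(P^(-1/s) L) and is handled by the weak
    (1,1) inequality for [hlmax]; the second one is dominated by a function G
    whose integral is O(P^(1-1/s) L) ([nontangential_max_split]).  With
    P = 2^(ms), the numbers u_k = 2^k |{N f > 2^k}| are, for every m >= 0,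
    bounded by C 2^(-m) L plus the terms of a sequence of sum
    O(2^(m(s-1)) L): this says that u belongs to weak l^s, with norm O(L).
    Since u is also bounded by C L, summing over the levels 2^(-m) yields
    (sum_k u_k^r)^(1/r) <= C L / (1 - 2^(-(r-s))) for r > s
    ([real_interpolation_sum]).  This is the only place where r approaching s
    costs anything, and it costs O(1 / (1/s - 1/r)) ([geometric_gap]).

    Finally, if 2^k < g^*(t) <= 2^(k+1) then t < |{g > 2^k}|, so that the
    integral defining the L^{1,r} quasi-norm of g = N f is at most
    2^r sum_k u_k^r ([lorentz1_norm_le]); for r = +oo the bound on u is
    enough.  Taking the infimum over decompositions gives the theorem with
    c_r = c / (1/s - 1/r). *)

(** * Geometry and Borel structure of R^n *)

Section geometry.
Context {R : realType} {n : nat}.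
Implicit Types (x y c : 'rV[R]_n) (r : R).
Local Notation mu := (@lebesgue_rV R n).

Lemma normr_coord x i : `|x 0 i| <= `|x|.
Proof.
rewrite [leRHS]mx_normrE.
exact: (le_bigmax _ (fun ij : 'I_1 * 'I_n => `|x ij.1 ij.2|) (0, i)).
Qed.

Lemma normr_rV_le x r : 0 <= r -> (forall i, `|x 0 i| <= r) -> `|x| <= r.
Proof.
move=> r0 h; rewrite [leLHS]mx_normrE; apply/bigmax_leP; split => // -[i j] _ /=.
by rewrite ord1.
Qed.

Lemma in_ball c r x : ball c r x <-> `|c - x| < r.
Proof. by rewrite -ball_normE. Qed.

Lemma ball_rVE c r : 0 < r ->
  ball c r = \bigcap_(i in [set: 'I_n])
    (fun x => x 0 i) @^-1` `]c 0 i - r, c 0 i + r[.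
Proof.
move=> r0; apply/seteqP; split => x.
  move=> /in_ball h i _ /=; rewrite in_itv /= -ltr_distlC.
  by apply: le_lt_trans h; have := normr_coord (c - x) i; rewrite !mxE.
move=> h; apply/in_ball; rewrite [ltLHS]mx_normrE.
apply/bigmax_ltP; split => // -[i j] _ /=; rewrite ord1 !mxE.
by have := h j I; rewrite /= in_itv /= -ltr_distlC.
Qed.

Lemma measurable_ball_rV c r : measurable (ball c r).
Proof.
have [r0|r0] := ltP 0 r; last first.
  rewrite (_ : ball c r = set0); first exact: measurable0.
  by apply/seteqP; split => // x /in_ball; rewrite ltNge (le_trans r0).
rewrite ball_rVE//; apply: fin_bigcap_measurable => // i _.
by rewrite -[X in measurable X]setTI; exact: measurable_rV_coord.
Qed.

Lemma lebesgue_ball_le c r : 0 < r -> (mu (ball c r) <= ((2 * r) ^+ n)%:E)%E.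
Proof.
move=> r0.
have -> : (2 * r) ^+ n = \prod_(i < n) ((\row_j (c 0 j + r)) 0 i - (\row_j (c 0 j - r)) 0 i).
  transitivity (\prod_(i < n) (2 * r)); first by rewrite prodr_const card_ord.
  by apply: eq_bigr => i _; rewrite !mxE; lra.
rewrite -lebesgue_rV_box; last by move=> i; rewrite !mxE; lra.
set S := (X in (_ <= lebesgue_rV n X)%E).
have E : S = \bigcap_(i in [set: 'I_n]) (fun x => x 0 i) @^-1` `[c 0 i - r, c 0 i + r].
  apply/seteqP; split => x h i; first by move=> _ /=; rewrite in_itv/=; have := h i; rewrite !mxE.
  by have := h i I; rewrite /= in_itv/= !mxE.
apply: le_measure; rewrite ?inE.
- exact: measurable_ball_rV.
- rewrite E; apply: fin_bigcap_measurable => // i _.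
  by rewrite -[X in measurable X]setTI; exact: measurable_rV_coord.
- rewrite E ball_rVE// => x h i _; have := h i I; rewrite /= !in_itv/=.
  by case/andP => /ltW -> /ltW ->.
Qed.

Definition qpoint (c : 'rV[rat]_n) : 'rV[R]_n := \row_i ratr (c 0 i).

(** The norm of ['rV[R]_n] is the sup norm, so balls are open cubes.  Those
    with rational centre and radius form a countable family, which keeps the
    maximal function below a countable supremum. *)
Definition qball (k : 'rV[rat]_n * rat) : set 'rV[R]_n :=
  ball (qpoint k.1) (ratr k.2).

Lemma rat_approx (x : 'rV[R]_n) (e : R) : 0 < e ->
  exists c : 'rV[rat]_n, `|x - qpoint c| < e.
Proof.
move=> e0.
have h i : exists q : rat, `|x 0 i - ratr q| < e.
  have [q] := @rat_in_itvoo R (x 0 i - e) (x 0 i + e) ltac:(lra).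
  by rewrite in_itv/= -ltr_distlC => qe; exists q.
have [q hq] := choice h.
exists (\row_i q i); rewrite [ltLHS]mx_normrE; apply/bigmax_ltP; split => // -[i j] _ /=.
by rewrite ord1 !mxE.
Qed.

(** Rational balls are as good as all balls for averaging, up to a constant
    factor in the radius. *)
Lemma ball_sub_qball x (r s : R) : 0 < r -> r < s ->
  exists k, [/\ ball x r `<=` qball k, 0 < ratr k.2 :> R & ratr k.2 < s].
Proof.
move=> r0 rs; pose e := (s - r) / 2.
have e0 : 0 < e by rewrite /e; lra.
have [c hc] := rat_approx x e0.
have [q] := @rat_in_itvoo R (r + e) s ltac:(rewrite /e; lra).
rewrite in_itv/= => /andP[q1 q2]; exists (c, q); split => //=; last by lra.
move=> y /in_ball xy; apply/in_ball => /=.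
rewrite (_ : _ - y = (qpoint c - x) + (x - y)); last by rewrite addrA subrK.
by rewrite (le_lt_trans (ler_normD _ _))// (distrC _ x); lra.
Qed.

Lemma open_measurable_rV (U : set 'rV[R]_n) : open U -> measurable U.
Proof.
move=> oU; pose K := [set k : 'rV[rat]_n * rat | qball k `<=` U].
have -> : U = \bigcup_k (if k \in K then qball k else set0).
  apply/seteqP; split => x; last first.
    by move=> -[k _]; case: ifPn => // /[!inE] /[apply].
  move=> Ux; have /nbhs_ballP[e /= e0 he] := open_nbhs_nbhs (conj oU Ux).
  have [c hc] := @rat_approx x (e/2) ltac:(lra).
  have [q] := @rat_in_itvoo R `|x - qpoint c| (e/2) hc.
  rewrite in_itv/= => /andP[q1 q2]; exists (c, q) => //.
  rewrite mem_set; first by apply/in_ball; rewrite distrC.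
  move=> y /in_ball /= cy; apply: he; apply/in_ball.
  rewrite (_ : _ - y = (x - qpoint c) + (qpoint c - y)); last by rewrite addrA subrK.
  by rewrite (le_lt_trans (ler_normD _ _))//; lra.
apply: countable_bigcupT_measurable => // k; case: ifP => // _; exact: measurable_ball_rV.
Qed.

Lemma continuous_measurable_rV (f : 'rV[R]_n -> R) :
  continuous f -> measurable_fun setT f.
Proof.
move=> cf; apply: (measurability _ (RGenOpens.measurableE R)) => _ [_ [a [b ->] <-]].
rewrite setTI; apply: open_measurable_rV; apply: open_comp => // x _; exact: cf.
Qed.

Lemma lsc_measurable_rV (f : 'rV[R]_n -> \bar R) :
  (forall a : R, open [set x | (a%:E < f x)%E]) -> measurable_fun setT f.
Proof.
move=> h; apply: (measurability _ (ErealGenOInfty.measurableE R)) => _ [_ [a ->] <-].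
rewrite setTI; apply: open_measurable_rV.
rewrite (_ : _ @^-1` _ = [set x | (a%:E < f x)%E])//.
by apply/seteqP; split => x /=; rewrite in_itv/= andbT.
Qed.

End geometry.

Section integral_mono.
Local Open Scope ereal_scope.
Context d (T : measurableType d) {R : realType}.
Variable mu : {measure set T -> \bar R}.

(** The integral of a nonnegative function is a supremum over the simple
    functions below it, hence is monotone.  This is used for the integrand of
    the Lorentz norm, which is built from a rearrangement. *)
Lemma ge0_integral_mono (D : set T) (f g : T -> \bar R) :
  (forall x, D x -> 0 <= f x) -> (forall x, D x -> f x <= g x) ->
  \int[mu]_(x in D) f x <= \int[mu]_(x in D) g x.
Proof.
move=> f0 fg; rewrite !(integral_mkcond D).
have F0 x : 0 <= (f \_ D) x by apply: erestrict_ge0.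
have G0 x : 0 <= (g \_ D) x.
  by apply: erestrict_ge0 => // t Dt; rewrite (le_trans (f0 _ Dt))// fg.
rewrite !ge0_integralTE//; apply: ereal_sup_le => _ [h hf <-]; exists h => //= x.
by rewrite (le_trans (hf x))//; exact: lee_restrict.
Qed.

End integral_mono.

(** * Vitali covering and the weak (1,1) inequality *)

Lemma measure_bigsetU_seq d (T : measurableType d) (R : realType)
    (m : {measure set T -> \bar R}) (I : Type) (F : I -> set T) (s : seq I) :
  (forall i, measurable (F i)) ->
  (m (\big[setU/set0]_(i <- s) F i) <= \sum_(i <- s) m (F i))%E.
Proof.
move=> mF; elim: s => [|i s ih]; first by rewrite !big_nil measure0.
rewrite !big_cons (le_trans (measureU2 _ _ _))//; last by rewrite leeD2l.
exact: bigsetU_measurable.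
Qed.

(** Greedy selection: keep a ball of largest radius, discard the balls that
    meet it (its triple contains them), and repeat with the rest. *)
Lemma vitali_finite_ball (R : realType) (V : normedModType R) (T : eqType)
    (c : T -> V) (r : T -> R) (s : seq T) :
  (forall i, i \in s -> 0 < r i) ->
  exists D : seq T, [/\ {subset D <= s}, uniq D,
    {in D &, forall i j, i != j -> ball (c i) (r i) `&` ball (c j) (r j) = set0} &
    forall i, i \in s -> exists2 j, j \in D &
      ball (c i) (r i) `<=` ball (c j) (3 * r j)].
Proof.
have [m] := ubnP (size s); elim: m s => // m ih [|i0 s] sm r0.
  by exists [::]; split.
have [j js jmax] : exists2 j, j \in i0 :: s & forall i, i \in i0 :: s -> r i <= r j.
  elim: s i0 {sm r0} => [|i1 s ihs] i0.
    by exists i0; rewrite ?mem_head// => i; rewrite inE => /eqP ->.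
  have [j js jmax] := ihs i1; have [rji|rij] := leP (r j) (r i0).
    exists i0; rewrite ?mem_head// => i; rewrite inE => /predU1P[->//|/jmax].
    by move/le_trans; apply.
  exists j; first by rewrite inE js orbT.
  by move=> i; rewrite inE => /predU1P[->|/jmax//]; exact: ltW.
set s0 := i0 :: s in sm js jmax r0 *.
pose dj i := `[< ball (c i) (r i) `&` ball (c j) (r j) = set0 >].
have djj : ~~ dj j.
  apply/asboolP; rewrite setIid => /seteqP[+ _] => /(_ (c j)); apply.
  exact: (ballxx _ (r0 _ js)).
have [D [Ds uD dD cD]] : exists D : seq T, [/\ {subset D <= seq.filter dj s0}, uniq D,
    {in D &, forall i j, i != j -> ball (c i) (r i) `&` ball (c j) (r j) = set0} &
    forall i, i \in seq.filter dj s0 -> exists2 j, j \in D &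
      ball (c i) (r i) `<=` ball (c j) (3 * r j)].
  apply: ih => [|i]; last by rewrite mem_filter => /andP[_]; exact: r0.
  rewrite -ltnS (leq_trans _ sm)// ltnS.
  have -> : size s0 = (count dj s0 + count (predC dj) s0)%N by rewrite count_predC.
  rewrite size_filter -addn1 leq_add2l -has_count; apply/hasP; exists j => //.
exists (j :: D); split.
- move=> i; rewrite inE => /predU1P[->//|/Ds]; by rewrite mem_filter => /andP[].
- rewrite /= uD andbT; apply/negP => /Ds; rewrite mem_filter => /andP[].
  by rewrite (negbTE djj).
- have Dj i : i \in D -> ball (c i) (r i) `&` ball (c j) (r j) = set0.
    by move=> /Ds; rewrite mem_filter => /andP[/asboolP].
  move=> i k; rewrite !inE => /predU1P[->|iD] /predU1P[->|kD].
  + by rewrite eqxx.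
  + by rewrite setIC Dj.
  + by rewrite Dj.
  + exact: dD.
- move=> i is0; have [di|] := boolP (dj i).
    have [|k kD hk] := cD i; first by rewrite mem_filter di.
    by exists k => //; rewrite inE kD orbT.
  move/asboolP/eqP/set0P => [z []]; rewrite -!ball_normE /= => h1 h2.
  exists j; rewrite ?mem_head// => y /= h3.
  have rij := jmax _ is0.
  rewrite (_ : c j - y = (c j - z) - (c i - z) + (c i - y)); last first.
    by rewrite opprB !subrKA.
  rewrite (le_lt_trans (ler_normD _ _))//.
  have := ler_normB (c j - z) (c i - z); lra.
Qed.

Section maximal_function.
Context {R : realType} {n : nat}.
Local Notation mu := (@lebesgue_rV R n).
Implicit Types (B : 'rV[R]_n -> \bar R).

(** The uncentred Hardy-Littlewood maximal function over rational cubes.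
    Dividing by the nth power of the radius instead of the volume only changes
    constants. *)
Definition hlmax B (x : 'rV[R]_n) : \bar R :=
  ereal_sup [set ((ratr k.2 ^- n)%:E * \int[mu]_(z in qball k) B z)%E |
    k in [set k : 'rV[rat]_n * rat | qball k x]].

Lemma qball_gt0 k (x : 'rV[R]_n) : qball k x -> 0 < ratr k.2 :> R.
Proof. by move=> /in_ball; apply: le_lt_trans. Qed.

Lemma hlmax_lsc B (a : R) : open [set x | (a%:E < hlmax B x)%E].
Proof.
rewrite openE => x /= /ereal_sup_gt[_ [k kx <-] ak].
have : nbhs x (qball k) by apply: open_nbhs_nbhs; split => //; exact: ball_open.
apply: filterS => y ky; apply: (lt_le_trans ak).
by apply: ereal_sup_ubound; exists k.
Qed.

Lemma measurable_hlmax B : measurable_fun setT (hlmax B).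
Proof. by apply: lsc_measurable_rV => a; exact: hlmax_lsc. Qed.

Lemma hlmax_ge0 B x : (forall z, 0 <= B z)%E -> (0 <= hlmax B x)%E.
Proof.
move=> B0; have [|k [kx _ _]] := @ball_sub_qball _ _ x 1 2 ltr01; first by lra.
apply: le_ereal_sup_tmp; exists ((ratr k.2 ^- n)%:E * \int[mu]_(z in qball k) B z)%E.
  by exists k => //; apply/kx/ballxx.
have kx' : qball k x by apply/kx/ballxx.
rewrite mule_ge0 ?integral_ge0// lee_fin invr_ge0 exprn_ge0//.
by rewrite ltW// (qball_gt0 kx').
Qed.

Lemma integral_ball_le_hlmax B x (r : R) : (forall z, 0 <= B z)%E ->
  measurable_fun setT B -> 0 < r ->
  (\int[mu]_(z in ball x r) B z <= ((2 * r) ^+ n)%:E * hlmax B x)%E.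
Proof.
move=> B0 mB r0.
have [|k [kx k0 kr]] := @ball_sub_qball _ _ x r (2 * r) r0; first by lra.
have kx' : qball k x by apply/kx/ballxx.
apply: (@le_trans _ _ (\int[mu]_(z in qball k) B z)%E).
  apply: ge0_subset_integral => //; try exact: measurable_ball_rV.
  exact: measurable_funTS.
apply: (@le_trans _ _ ((ratr k.2 ^+ n)%:E * ((ratr k.2 ^- n)%:E * \int[mu]_(z in qball k) B z))%E).
  by rewrite muleA -EFinM mulfV ?mul1e// expf_neq0// gt_eqF.
apply: lee_pmul.
- by rewrite lee_fin exprn_ge0// ltW.
- by rewrite mule_ge0 ?integral_ge0// lee_fin invr_ge0 exprn_ge0// ltW.
- by rewrite lee_fin lerXn2r ?nnegrE//; lra.
- by apply: ereal_sup_ubound; exists k.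
Qed.

(** The level set is a countable union of balls on which the average of B
    exceeds l.  For finitely many of them, a Vitali subfamily of disjoint
    balls has triples that cover, of volume (6 r)^n <= 6^n l^-1 times the
    integral of B over the ball; the general case follows by continuity of the
    measure. *)
Lemma hlmax_weak11 B (l : R) : (forall z, 0 <= B z)%E ->
  measurable_fun setT B -> 0 < l ->
  (l%:E * mu [set x | l%:E < hlmax B x] <= (6 ^+ n)%:E * \int[mu]_z B z)%E.
Proof.
move=> B0 mB l0.
pose G := [set k : 'rV[rat]_n * rat | 0 < ratr k.2 :> R /\
   (l%:E < (ratr k.2 ^- n)%:E * \int[mu]_(z in qball k) B z)%E].
pose s m := [seq k <- pmap (@pickle_inv ('rV[rat]_n * rat)%type) (iota 0 m) | k \in G].
pose F m : set 'rV[R]_n := \big[setU/set0]_(k <- s m) qball k.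
have sP m k : k \in s m = (pickle k < m)%N && (k \in G).
  rewrite mem_filter andbC mem_pmap; congr andb.
  apply/mapP/idP => [[i]|km]; last first.
    by exists (pickle k); rewrite ?mem_iota// pickleK_inv.
  rewrite mem_iota add0n => im; rewrite /pickle_inv.
  case: unpickle => //= k'; case: eqP => //= pk [->].
  by rewrite pk.
have mF m : measurable (F m).
  by apply: bigsetU_measurable => k _; exact: measurable_ball_rV.
have FE : [set x | (l%:E < hlmax B x)%E] = \bigcup_m F m.
  apply/seteqP; split => x.
    move=> /ereal_sup_gt[_ [k kx <-] lk].
    exists (pickle k).+1 => //; rewrite /F -bigcup_seq; exists k => //=.
    by rewrite sP ltnSn mem_set//; split => //; exact: qball_gt0 kx.
  move=> [m _]; rewrite /F -bigcup_seq => -[k /=]; rewrite sP => /andP[_ /set_mem[k0 lk] kx].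
  by apply: (lt_le_trans lk); apply: ereal_sup_ubound; exists k.
have Fbound m : (l%:E * mu (F m) <= (6 ^+ n)%:E * \int[mu]_z B z)%E.
  have [k|D [Ds uD dD cD]] := @vitali_finite_ball R 'rV[R]_n _ (fun k => qpoint k.1)
    (fun k => ratr k.2) (s m).
    by rewrite sP => /andP[_ /set_mem[]].
  apply: (@le_trans _ _ (l%:E * \sum_(k <- D) mu (ball (qpoint k.1) (3 * ratr k.2) : set 'rV[R]_n))%E).
    apply: lee_wpmul2l; first by rewrite lee_fin ltW.
    apply: (le_trans _ (measure_bigsetU_seq _ _ _)) => [|k]; last exact: measurable_ball_rV.
    apply: le_measure; rewrite ?inE//.
      by apply: bigsetU_measurable => k _; exact: measurable_ball_rV.
    rewrite /F -!bigcup_seq => x [k /= /cD[j jD hj] kx]; exists j => //.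
    exact: hj.
  apply: (@le_trans _ _ ((6 ^+ n)%:E * \sum_(k <- D) \int[mu]_(z in qball k) B z)%E).
    rewrite !ge0_sume_distrr//; last by move=> *; exact: integral_ge0.
    rewrite big_seq [leRHS]big_seq; apply: lee_sum => k /Ds.
    rewrite sP => /andP[_ /set_mem[k0 lk]].
    apply: (@le_trans _ _ (l%:E * ((6 ^+ n * ratr k.2 ^+ n)%R%:E))%E).
      apply: lee_wpmul2l; first by rewrite lee_fin ltW.
      apply: (le_trans (lebesgue_ball_le _ _)); first by lra.
      by rewrite -exprMn mulrA (_ : 2 * 3 = 6)//; lra.
    rewrite EFinM muleCA; apply: lee_wpmul2l; first by rewrite lee_fin exprn_ge0.
    have rn0 : 0 < ratr k.2 ^+ n :> R by rewrite exprn_gt0.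
    rewrite (_ : (\int[mu]_(z in qball k) B z =
        (ratr k.2 ^+ n)%:E * ((ratr k.2 ^- n)%:E * \int[mu]_(z in qball k) B z))%E); last first.
      by rewrite muleA -EFinM mulfV ?mul1e// gt_eqF.
    rewrite muleC.
    by apply: lee_wpmul2l; [rewrite lee_fin ltW|exact: ltW].
  apply: lee_wpmul2l; first by rewrite lee_fin exprn_ge0.
  rewrite -(@ge0_integral_bigsetU _ _ _ mu _ (@qball R n))//.
  - apply: ge0_subset_integral => //.
    by apply: bigsetU_measurable => k _; exact: measurable_ball_rV.
  - by move=> k; exact: measurable_ball_rV.
  - apply/trivIsetP => i j /= iD jD ij; exact: dD.
  - exact: measurable_funTS.
have cvF : mu \o F @ \oo --> mu (\bigcup_m F m).
  apply: nondecreasing_cvg_mu => //; first exact: bigcupT_measurable.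
  move=> i j ij; apply/subsetPset; rewrite /F -!bigcup_seq => x [k /=].
  by rewrite sP => /andP[ki kG kx]; exists k => //=; rewrite sP kG (leq_trans ki ij).
rewrite FE muleC -lee_pdivlMr//.
rewrite -(cvg_lim _ cvF)//; apply: lime_le.
  by apply/cvg_ex; exists (mu (\bigcup_m F m)).
by apply: nearW => m /=; rewrite lee_pdivlMr// muleC; exact: Fbound.
Qed.

End maximal_function.

(** * Dyadic layer-cake estimates *)

Section dyadic.
Local Open Scope ereal_scope.
Context d (T : measurableType d) {R : realType}.
Variable mu : {measure set T -> \bar R}.

(** If 2^m A < g <= 2^(m+1) A, the right-hand side is A + (1 + 2 + ... + 2^m)
    A = 2^(m+1) A. *)
Lemma dyadic_majorant (g : \bar R) (A : R) : (0 < A)%R -> 0 <= g ->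
  g <= A%:E + \sum_(0 <= k <oo) (if (2 ^+ k * A)%:E < g then (2 ^+ k * A)%:E else 0).
Proof.
move=> A0 g0; set S := \sum_(0 <= k <oo) _.
have t0 k : 0 <= (if (2 ^+ k * A)%:E < g then (2 ^+ k * A)%:E else 0).
  by case: ifP => // _; rewrite lee_fin mulr_ge0// ?exprn_ge0// ltW.
have H K : mine g (2 ^+ K * A)%:E <= A%:E + S.
  apply: (@le_trans _ _ (A%:E + \sum_(0 <= k < K) (if (2 ^+ k * A)%:E < g then (2 ^+ k * A)%:E else 0))); last first.
    by rewrite leeD2l//; apply: nneseries_lim_ge => k _ _; exact: t0.
  elim: K => [|K ih].
    by rewrite big_geq// adde0 expr0 mul1r ge_min lexx orbT.
  rewrite big_nat_recr//= addeA.
  have [gK|Kg] := leP g (2 ^+ K * A)%:E.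
    rewrite adde0; apply: le_trans ih; rewrite le_min ge_min lexx/=.
    by rewrite ge_min gK.
  apply: (@le_trans _ _ (2 ^+ K.+1 * A)%:E); first by rewrite ge_min lexx orbT.
  rewrite min_r in ih; last exact: ltW.
  rewrite exprS (_ : 2 * _ * A = 2 ^+ K * A + 2 ^+ K * A)%R; last by lra.
  by rewrite EFinD leeD2r.
have AS : (A%:E + S) \is a fin_num \/ A%:E + S = +oo.
  have : 0 <= A%:E + S by rewrite adde_ge0 ?lee_fin ?(ltW A0)// nneseries_ge0.
  by case: (A%:E + S) => //= [x _|_]; [left|right].
have tA (x : R) : exists K, (x <= 2 ^+ K * A)%R.
  exists (truncn (x / A)).+1; rewrite -ler_pdivrMr//.
  rewrite (le_trans (ltW (truncnS_gt _)))// -natrX ler_nat ltnW//; exact: ltn_expl.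
case: AS => [AS|->]; last by rewrite leey.
have [K hK] := tA (fine (A%:E + S) + 1)%R.
have := H K; rewrite ge_min => /orP[//|].
rewrite -(fineK AS) lee_fin leNgt => /negP; case.
by rewrite (lt_le_trans _ hK)// ltrDl.
Qed.

Lemma ge0_integral_le_dyadic (D : set T) (g : T -> \bar R) (A : R) :
  measurable D -> measurable_fun setT g -> (forall x, 0 <= g x) -> (0 < A)%R ->
  \int[mu]_(x in D) g x <= A%:E * mu D +
    \sum_(0 <= k <oo) (2 ^+ k * A)%:E * mu [set x | (2 ^+ k * A)%:E < g x].
Proof.
move=> mD mg g0 A0.
pose S k : set T := [set x | (2 ^+ k * A)%:E < g x].
have mS k : measurable (S k).
  by rewrite -[X in measurable X]setTI; exact: emeasurable_fun_o_infty.
have A2 k : (0 <= 2 ^+ k * A)%R by rewrite mulr_ge0 ?exprn_ge0// ltW.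
pose h k (x : T) := (2 ^+ k * A)%:E * (\1_(S k) x)%:E.
have mh k : measurable_fun D (h k).
  apply: measurable_funTS; apply: measurable_funeM; apply/measurable_EFinP.
  exact: measurable_indic.
have h0 k x : 0 <= h k x by rewrite mule_ge0// lee_fin.
apply: (@le_trans _ _ (\int[mu]_(x in D) (cst A%:E x + \sum_(0 <= k <oo) h k x))).
  apply: ge0_integral_mono => // x _; apply: (le_trans (dyadic_majorant A0 (g0 x))).
  apply: leeD => //; apply: lee_nneseries => k _.
    by case: ifP => // _; rewrite lee_fin.
  rewrite /h indicE; have [h1|h1] := boolP ((2 ^+ k * A)%:E < g x).
    by rewrite mem_set// mule1.
  by rewrite memNset ?mule0//; exact/negP.
rewrite ge0_integralD//; last 3 first.
- by move=> x _; rewrite lee_fin ltW.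
- by move=> x _; apply: nneseries_ge0 => k _ _; exact: h0.
- by apply: ge0_emeasurable_sum => // k x _ _; exact: h0.
rewrite integral_cst//; apply: leeD => //.
rewrite integral_nneseries//; apply: lee_nneseries => k _; first by move=> _; apply: integral_ge0.
rewrite ge0_integralZl_EFin//; last first.
  by apply/measurable_EFinP; exact: measurable_indic.
apply: lee_wpmul2l; first by rewrite lee_fin.
rewrite integral_indic//; apply: le_measure; rewrite ?inE; [exact: measurableI|exact: mS|by move=> x []].
Qed.

(** The sum is geometric, hence at most twice its last nonzero term, which is
    smaller than g. *)
Lemma dyadic_minorant (g : \bar R) (y : R) J : (0 < y)%R -> 0 <= g ->
  \sum_(j < J) (if (2 ^+ j * y)%:E < g then (2 ^+ j * y)%:E else 0) <= 2%:E * g.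
Proof.
move=> y0 g0; elim: J => [|J ih]; first by rewrite big_ord0 mule_ge0// lee_fin.
rewrite big_ord_recr/=; have [gJ|Jg] := leP g (2 ^+ J * y)%:E.
  by rewrite adde0.
rewrite (@le_trans _ _ (2%:E * (2 ^+ J * y)%:E))//; last first.
  by rewrite lee_wpmul2l ?lee_fin// ltW.
apply: (@le_trans _ _ (\sum_(j < J) (2 ^+ j * y)%:E + (2 ^+ J * y)%:E)).
  rewrite leeD2r//; apply: lee_sum => j _.
  by case: ifP => // _; rewrite lee_fin mulr_ge0 ?exprn_ge0// ltW.
rewrite sumEFin -EFinD -EFinM lee_fin.
have S K : (\sum_(j < K) 2 ^+ j * y <= 2 ^+ K * y :> R)%R.
  elim: K => [|K ihK]; first by rewrite big_ord0 mulr_ge0 ?exprn_ge0// ltW.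
  by rewrite big_ord_recr/= exprS; lra.
by have := S J; lra.
Qed.

Lemma dyadic_sum_le_integral (g : T -> \bar R) (y : R) J :
  measurable_fun setT g -> (forall x, 0 <= g x) -> (0 < y)%R ->
  \sum_(j < J) (2 ^+ j * y)%:E * mu [set x | (2 ^+ j * y)%:E < g x]
    <= 2%:E * \int[mu]_x g x.
Proof.
move=> mg g0 y0.
pose S k : set T := [set x | (2 ^+ k * y)%:E < g x].
have mS k : measurable (S k).
  by rewrite -[X in measurable X]setTI; exact: emeasurable_fun_o_infty.
have A2 k : (0 <= 2 ^+ k * y)%R by rewrite mulr_ge0 ?exprn_ge0// ltW.
pose h k (x : T) := (2 ^+ k * y)%:E * (\1_(S k) x)%:E.
have mh k : measurable_fun setT (h k).
  apply: measurable_funeM; apply/measurable_EFinP.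
  exact: measurable_indic.
have h0 k x : 0 <= h k x by rewrite mule_ge0// lee_fin.
rewrite -ge0_integralZl_EFin//.
apply: (@le_trans _ _ (\int[mu]_x (\sum_(j < J) h j x))); last first.
  apply: ge0_integral_mono => x _; first exact: sume_ge0.
  apply: le_trans (dyadic_minorant J y0 (g0 x)); apply: lee_sum => k _.
  rewrite /h indicE; have [h1|h1] := boolP ((2 ^+ k * y)%:E < g x).
    by rewrite mem_set// mule1.
  by rewrite memNset ?mule0//; exact/negP.
rewrite ge0_integral_sum//; apply: lee_sum => k _.
rewrite ge0_integralZl_EFin//; last first.
  by apply/measurable_EFinP; exact: measurable_indic.
by rewrite integral_indic// setIT.
Qed.

End dyadic.

(** * Maximal functions of L^q functions, uniformly in q *)

Lemma nneseries_le (R : realType) (u : nat -> \bar R) (c : \bar R) :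
  (forall k, 0 <= u k)%E -> (forall K, \sum_(k < K) u k <= c)%E ->
  (\sum_(0 <= k <oo) u k <= c)%E.
Proof.
move=> u0 h; apply: lime_le; first exact: is_cvg_nneseries.
by apply: nearW => K; rewrite big_mkord.
Qed.

Lemma sum_geometric_le (R : realType) (x : R) K : 0 <= x < 1 ->
  \sum_(k < K) x ^+ k <= (1 - x)^-1.
Proof.
move=> /andP[x0 x1]; rewrite -[leRHS]mul1r ler_pdivlMr ?subr_gt0//.
have -> : (\sum_(k < K) x ^+ k) * (1 - x) = 1 - x ^+ K.
  elim: K => [|K ih]; first by rewrite big_ord0 expr0 mul0r subrr.
  by rewrite big_ord_recr/= mulrDl ih exprS; lra.
by rewrite gerBl exprn_ge0.
Qed.

(** From exp u >= 1 + u and ln 2 >= 1/2, 2^x >= 1 + x/2. *)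
Lemma exp2_gap (R : realType) (x : R) : 0 < x <= 1 -> x / 3 <= 1 - 2 `^ (- x).
Proof.
move=> /andP[x0 x1]; rewrite powRN.
have l2 : 2^-1 <= ln 2 :> R.
  have := @le_ln1Dx R (- 2^-1) ltac:(lra).
  by rewrite (_ : 1 + - 2^-1 = 2^-1 :> R) ?lnV ?posrE//; lra.
have h : 1 + x / 2 <= 2 `^ x.
  rewrite /powR gt_eqF//; apply: le_trans (expR_ge1Dx _).
  by rewrite lerD2l ler_wpM2l// ltW.
have : (2 `^ x)^-1 <= (1 + x / 2)^-1.
  by rewrite lef_pV2 ?posrE//; lra.
have : (1 + x / 2)^-1 <= 1 - x / 3; last by lra.
by rewrite -[leLHS]mul1r ler_pdivrMr; nra.
Qed.

Lemma conjugate_ge2 (R : realType) (p q : R) : 1 < q -> q <= 2 ->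
  p^-1 + q^-1 = 1 -> 2 <= p.
Proof.
move=> q1 q2 pq; have q0 : 0 < q by lra.
have h0 : 2^-1 <= q^-1 by rewrite lef_pV2 ?posrE.
have h1 : q^-1 < 1 by rewrite invf_lt1.
have p0 : 0 < p by rewrite -invr_gt0; lra.
by rewrite -[leRHS]invrK -[leLHS]invrK lef_pV2 ?posrE ?invr_gt0//; lra.
Qed.

Section weak_qq.
Context {R : realType} {n : nat}.
Local Notation mu := (@lebesgue_rV R n).
Implicit Types (f : 'rV[R]_n -> R).

(** Only the part of f where |f| > l matters, since the rest contributes at
    most 2^n l to the maximal function; on that part |f| <= l^(1-q) |f|^q, and
    the weak (1,1) inequality gives a constant independent of q. *)
Lemma hlmax_weakqq f (l q : R) : measurable_fun setT f -> 0 < l -> 1 <= q ->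
  ((l `^ q)%:E * mu [set x | (2 ^+ n.+1 * l)%:E < hlmax (fun z => `|f z|%:E) x]
     <= (3 ^+ n)%:E * \int[mu]_z (`|f z| `^ q)%:E)%E.
Proof.
move=> mf l0 q1.
have mnf : measurable_fun setT (fun z => `|f z|) by exact: measurableT_comp.
pose S := [set z | l < `|f z|].
have mS : measurable S.
  have := mnf measurableT `]l, +oo[%classic (measurable_itv _); rewrite setTI.
  by rewrite (_ : _ @^-1` _ = S)//; apply/seteqP; split => z /=; rewrite in_itv/= andbT.
pose B z := `|f z|%:E; pose B1 z := (`|f z| * \1_S z)%:E.
have mB1 : measurable_fun setT B1.
  by apply/measurable_EFinP; apply: measurable_funM => //; exact: measurable_indic.
have B10 z : (0 <= B1 z)%E by rewrite lee_fin mulr_ge0.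
have BB1 z : (B z <= B1 z + l%:E)%E.
  rewrite -EFinD lee_fin indicE; have [h|h] := ltP l `|f z|.
    by rewrite mem_set// mulr1 lerDl ltW.
  by rewrite memNset ?mulr0 ?add0r// /S/= ltNge h.
have MB x : (hlmax B x <= hlmax B1 x + (2 ^+ n * l)%:E)%E.
  apply: ge_ereal_sup => _ [k kx <-].
  have k0 := qball_gt0 kx.
  apply: (@le_trans _ _ ((ratr k.2 ^- n)%:E * \int[mu]_(z in qball k) B1 z + (2 ^+ n * l)%:E)%E); last first.
    by rewrite leeD2r//; apply: ereal_sup_ubound; exists k.
  apply: (@le_trans _ _ ((ratr k.2 ^- n)%:E * (\int[mu]_(z in qball k) B1 z + l%:E * mu (qball k)))%E).
    apply: lee_wpmul2l; first by rewrite lee_fin invr_ge0 exprn_ge0// ltW.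
    rewrite -integral_cst; last exact: measurable_ball_rV.
    rewrite -ge0_integralD//; last 3 first.
    - exact: measurable_ball_rV.
    - exact: (measurable_funTS mB1).
    - by move=> z _; rewrite lee_fin ltW.
    apply: ge0_integral_mono => z _; [by rewrite lee_fin|exact: BB1].
  rewrite ge0_muleDr ?integral_ge0//; last by rewrite mule_ge0// lee_fin ltW.
  rewrite leeD2l//.
  apply: (@le_trans _ _ ((ratr k.2 ^- n)%:E * (l%:E * ((2 * ratr k.2) ^+ n)%:E))%E).
    apply: lee_wpmul2l; first by rewrite lee_fin invr_ge0 exprn_ge0// ltW.
    by apply: lee_wpmul2l; rewrite ?lee_fin ?(ltW l0)//; exact: lebesgue_ball_le.
  rewrite -!EFinM lee_fin [(2 * ratr k.2) ^+ n]exprMn.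
  have r0 : ratr k.2 ^+ n != 0 :> R by rewrite expf_neq0// gt_eqF.
  move: (ratr k.2 ^+ n : R) r0 => rn rn0.
  by rewrite (_ : rn^-1 * (l * (2 ^+ n * rn)) = (rn^-1 * rn) * (2 ^+ n * l)); [rewrite mulVf ?mul1r|lra].
have sub : [set x | ((2 ^+ n.+1 * l)%:E < hlmax B x)%E] `<=`
    [set x | ((2 ^+ n * l)%:E < hlmax B1 x)%E].
  move=> x /= /lt_le_trans/(_ (MB x)).
  rewrite exprS (_ : 2 * _ * l = 2 ^+ n * l + 2 ^+ n * l); last by lra.
  by rewrite EFinD lteD2rE.
have mM (b : R) (B2 : 'rV[R]_n -> \bar R) : measurable [set x | (b%:E < hlmax B2 x)%E].
  by apply: open_measurable_rV; exact: hlmax_lsc.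
have B1q z : (B1 z <= ((l `^ (q - 1))^-1)%:E * (`|f z| `^ q)%:E)%E.
  rewrite lee_fin indicE; have [h|h] := ltP l `|f z|; last first.
    by rewrite memNset ?mulr0 ?mulr_ge0 ?invr_ge0 ?powR_ge0// /S/= ltNge h.
  rewrite mem_set// mulr1 mulrC ler_pdivlMr ?powR_gt0//.
  rewrite -(@mulr_powRB1 _ `|f z|)//; last by lra.
  by rewrite ler_wpM2l// ge0_ler_powR ?nnegrE ?subr_ge0// ltW.
have l20 : 0 < 2 ^+ n * l by rewrite mulr_gt0// exprn_gt0.
have := hlmax_weak11 B10 mB1 l20.
move=> W; have {}W : ((2 ^+ n * l)%:E * mu [set x | ((2 ^+ n.+1 * l)%:E < hlmax B x)%E] <=
   (6 ^+ n)%:E * (((l `^ (q - 1))^-1)%:E * \int[mu]_z (`|f z| `^ q)%:E))%E.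
  apply: (@le_trans _ _ ((2 ^+ n * l)%:E * mu [set x | ((2 ^+ n * l)%:E < hlmax B1 x)%E])%E).
    by apply: lee_wpmul2l; [rewrite lee_fin ltW|apply: le_measure; rewrite ?inE].
  apply: (le_trans W); apply: lee_wpmul2l; first by rewrite lee_fin exprn_ge0.
  rewrite -ge0_integralZl_EFin.
  - by apply: ge0_integral_mono => z _; [exact: B10|exact: B1q].
  - exact: measurableT.
  - by move=> z _; rewrite lee_fin powR_ge0.
  - by apply/measurable_EFinP; apply: (measurableT_comp (measurable_powR q)).
  - by rewrite invr_ge0 powR_ge0.
have lq : 0 < l `^ (q - 1) by rewrite powR_gt0.
have -> : l `^ q = (l `^ (q - 1) * 2 ^- n) * (2 ^+ n * l).
  rewrite -mulrA [X in _ * X]mulrA mulVf ?expf_neq0// mul1r -[X in _ * X]powRr1 ?(ltW l0)// -powRD ?subrK//.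
  by apply/implyP => _; rewrite gt_eqF.
rewrite EFinM -muleA.
apply: (@le_trans _ _ ((l `^ (q - 1) * 2 ^- n)%:E * ((6 ^+ n)%:E * (((l `^ (q - 1))^-1)%:E * \int[mu]_z (`|f z| `^ q)%:E)))%E).
  by apply: lee_wpmul2l W; rewrite lee_fin mulr_ge0 ?invr_ge0 ?exprn_ge0// ltW.
rewrite !muleA -!EFinM (_ : _ * _ * _ * _ = 3 ^+ n)//.
rewrite (_ : 6 = 2 * 3 :> R); last by lra.
rewrite exprMn [X in X * _](_ : _ = l `^ (q - 1) * 3 ^+ n); last first.
  by rewrite -mulrA (mulrA (2 ^- n)) mulVf ?mul1r// expf_neq0.
by rewrite mulrAC mulfV ?mul1r// gt_eqF.
Qed.

(** The weak (q,q) inequality at the levels 2^k A bounds the terms of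
    [ge0_integral_le_dyadic] by a geometric series of ratio 2^(1-q), whose sum
    is O(1/(q-1)) = O(p). *)
Lemma integral_hlmax_le (f : 'rV[R]_n -> R) (p q A V : R) (E : set 'rV[R]_n) :
  measurable_fun setT f -> measurable E -> 0 < A -> 0 <= V ->
  1 < q -> q <= 2 -> p^-1 + q^-1 = 1 ->
  (\int[mu]_z (`|f z| `^ q)%:E <= (A `^ q * V)%:E)%E ->
  (\int[mu]_(x in E) hlmax (fun z => `|f z|%:E) x <=
    (2 ^+ n.+1 * A)%:E * (mu E + (3 ^+ n * V * (3 * p))%:E))%E.
Proof.
move=> mf mE A0 V0 q1 q2 pq fV; pose B z := `|f z|%:E.
have n0 : 0 < 2 ^+ n.+1 * A by rewrite mulr_gt0// exprn_gt0.
have B0 z : (0 <= B z)%E by rewrite lee_fin.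
apply: (le_trans (ge0_integral_le_dyadic mu mE (measurable_hlmax B) _ n0)).
  by move=> x; exact: hlmax_ge0.
have p2 := conjugate_ge2 q1 q2 pq.
have q0 : 0 < q by lra.
have p0 : 0 < p by lra.
have pq' : p + q = p * q.
  have h1 : p * p^-1 = 1 by rewrite mulfV// gt_eqF.
  have h2 : q * q^-1 = 1 by rewrite mulfV// gt_eqF.
  have : p * q * (p^-1 + q^-1) = p * q by rewrite pq mulr1.
  rewrite mulrDr mulrAC h1 mul1r -mulrA h2 mulr1; lra.
rewrite ge0_muleDr ?lee_fin//; last by rewrite !mulr_ge0 ?exprn_ge0// ltW.
rewrite leeD2l//.
pose x := 2 `^ (- (q - 1)) : R.
have hx := @exp2_gap R (q - 1) ltac:(lra).
have x01 : 0 <= x < 1 by rewrite powR_ge0/= /x; lra.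
have xq k : x ^+ k * (2 ^+ k) `^ q = 2 ^+ k.
  elim: k => [|k ih]; first by rewrite !expr0 powR1 mul1r.
  rewrite !exprS powRM// ?exprn_ge0// mulrACA ih -powRD; last by rewrite pnatr_eq0 implybT.
  by rewrite opprB subrK powRr1.
apply: nneseries_le => [k|K]; first by rewrite mule_ge0// lee_fin mulr_ge0 ?exprn_ge0// ltW.
have Aq : 0 < A `^ q by rewrite powR_gt0.
apply: (@le_trans _ _ (\sum_(k < K) (2 ^+ n.+1 * A * (3 ^+ n * V) * x ^+ k)%:E)%E).
  apply: lee_sum => k _; have lk : 0 < 2 ^+ k * A by rewrite mulr_gt0 ?exprn_gt0.
  have W := hlmax_weakqq mf lk (ltW q1).
  pose m := mu [set t | ((2 ^+ n.+1 * (2 ^+ k * A))%:E < hlmax B t)%E].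
  rewrite mulrCA [X in (_ * X <= _)%E](_ : _ = m)//; rewrite -/B -/m in W.
  have {}W := le_trans W (lee_wpmul2l _ fV).
  have {}W := W (ltac:(by rewrite lee_fin exprn_ge0)).
  have -> : 2 ^+ n.+1 * (2 ^+ k * A) = 2 ^+ n.+1 * A * x ^+ k * (A `^ q)^-1 * (2 ^+ k * A) `^ q.
    rewrite -{1}(xq k) powRM ?exprn_ge0 ?(ltW A0)//.
    rewrite (_ : 2 ^+ n.+1 * A * x ^+ k * (A `^ q)^-1 * ((2 ^+ k) `^ q * A `^ q) =
      2 ^+ n.+1 * A * x ^+ k * (2 ^+ k) `^ q * ((A `^ q)^-1 * A `^ q)); last by lra.
    by rewrite mulVf ?gt_eqF//; lra.
  rewrite [X in (X * _)%E]EFinM -muleA.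
  apply: (@le_trans _ _ ((2 ^+ n.+1 * A * x ^+ k * (A `^ q)^-1)%:E * ((3 ^+ n)%:E * (A `^ q * V)%:E))%E).
    apply: lee_wpmul2l W; rewrite lee_fin !mulr_ge0 ?invr_ge0 ?exprn_ge0 ?(ltW A0) ?(ltW Aq)//.
    by case/andP: x01.
  rewrite -!EFinM lee_fin.
  rewrite [leLHS](_ : _ = 2 ^+ n.+1 * A * (3 ^+ n * V) * x ^+ k * ((A `^ q)^-1 * A `^ q)); last by lra.
  by rewrite mulVf ?mulr1// gt_eqF.
rewrite sumEFin lee_fin -mulr_sumr -!mulrA ler_wpM2l ?exprn_ge0// ler_wpM2l ?(ltW A0)//.
rewrite !ler_wpM2l ?exprn_ge0//.
apply: le_trans (sum_geometric_le K x01) _.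
have q10 : 0 < q - 1 by lra.
apply: (@le_trans _ _ (((q - 1) / 3)^-1)); first by rewrite lef_pV2 ?posrE//; rewrite -/x in hx; lra.
rewrite invf_div ler_pdivrMr//; nra.
Qed.

End weak_qq.

(** * Integrals against decaying kernels *)

Section kernel.
Context {R : realType} {n : nat}.
Local Notation mu := (@lebesgue_rV R n).
Implicit Types (x y z : 'rV[R]_n) (B : 'rV[R]_n -> \bar R).

Lemma hlmax_cst (c : R) x : 0 <= c -> (hlmax (fun=> c%:E) x <= (2 ^+ n * c)%:E)%E.
Proof.
move=> c0; apply: ge_ereal_sup => _ [k kx <-].
have k0 := qball_gt0 kx; rewrite integral_cst; last exact: measurable_ball_rV.
apply: (@le_trans _ _ ((ratr k.2 ^- n)%:E * (c%:E * ((2 * ratr k.2) ^+ n)%:E))%E).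
  apply: lee_wpmul2l; first by rewrite lee_fin invr_ge0 exprn_ge0// ltW.
  by apply: lee_wpmul2l; rewrite ?lee_fin//; exact: lebesgue_ball_le.
rewrite -!EFinM lee_fin [(2 * ratr k.2) ^+ n]exprMn.
have r0 : ratr k.2 ^+ n != 0 :> R by rewrite expf_neq0// gt_eqF.
move: (ratr k.2 ^+ n : R) r0 => rn rn0.
by rewrite (_ : rn^-1 * (c * (2 ^+ n * rn)) = (rn^-1 * rn) * (2 ^+ n * c)); [rewrite mulVf ?mul1r|lra].
Qed.

(** Take the least k with |x - z| < 2^k t: minimality bounds t + |x - z| below
    by 2^k t / 2. *)
Lemma annuli_cover (t : R) x z (m : nat) : 0 < t ->
  exists k, ball x (2 ^+ k * t) z /\
    (t + `|x - z|) ^- m <= (2 ^+ k * t / 2) ^- m.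
Proof.
move=> t0.
have h2 k : 0 < 2 ^+ k * t / 2 by rewrite divr_gt0 ?mulr_gt0 ?exprn_gt0.
have ex : exists k, `|x - z| < 2 ^+ k * t.
  exists (truncn (`|x - z| / t)).+1; rewrite -ltr_pdivrMr//.
  by rewrite (lt_le_trans (truncnS_gt _))// -natrX ler_nat ltnW//; exact: ltn_expl.
have [k hk kmin] := ex_minnP ex.
exists k; split; first exact/in_ball.
have n0 := normr_ge0 (x - z).
rewrite lef_pV2 ?posrE ?exprn_gt0//; last by lra.
rewrite lerXn2r ?nnegrE ?(ltW (h2 k))//; first by lra.
case: k kmin {hk} => [|k] kmin; first by rewrite expr0; lra.
have : ~~ (`|x - z| < 2 ^+ k * t) by apply/negP => /kmin; rewrite ltnn.
by rewrite -leNgt exprS; lra.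
Qed.

(** Cut the space into dyadic annuli of radii 2^k t around x: each contributes
    (2^k t)^-(n+1) times the integral of B over a ball of radius 2^k t, that
    is at most a multiple of 2^-k t^-1 hlmax B x. *)
Lemma integral_decay_le B x (t : R) : (forall z, 0 <= B z)%E ->
  measurable_fun setT B -> 0 < t ->
  (\int[mu]_z (B z * ((t + `|x - z|) ^- n.+1)%:E) <=
     (2 ^+ (2 * n).+2 * t^-1)%:E * hlmax B x)%E.
Proof.
move=> B0 mB t0.
have h2 k : 0 < 2 ^+ k * t by rewrite mulr_gt0 ?exprn_gt0.
pose w k := (2 ^+ k * t / 2) ^- n.+1.
have w0 k : 0 <= w k by rewrite invr_ge0 exprn_ge0// ltW// divr_gt0.
pose h k z := ((w k)%:E * (B z * (\1_(ball x (2 ^+ k * t)) z)%:E))%E.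
have mi k : measurable_fun setT (fun z => (B z * (\1_(ball x (2 ^+ k * t)) z)%:E)%E).
  apply: emeasurable_funM => //; apply/measurable_EFinP; apply: measurable_indic.
  exact: measurable_ball_rV.
have i0 k z : (0 <= B z * (\1_(ball x (2 ^+ k * t)) z)%:E)%E by rewrite mule_ge0// lee_fin.
have h0 k z : (0 <= h k z)%E by rewrite mule_ge0// lee_fin.
have mh k : measurable_fun setT (h k) by apply: measurable_funeM.
apply: (@le_trans _ _ (\int[mu]_z (\sum_(0 <= k <oo) h k z))%E).
  apply: ge0_integral_mono => z _.
    by rewrite mule_ge0// lee_fin invr_ge0 exprn_ge0// addr_ge0// ltW.
  have [k [kz hk]] := annuli_cover x z n.+1 t0.
  apply: (@le_trans _ _ (h k z)).
    rewrite /h indicE mem_set// mule1 muleC; apply: lee_wpmul2r => //.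
  apply: (@le_trans _ _ (\sum_(0 <= j < k.+1) h j z)%E).
    by rewrite big_nat_recr//= leeDr// sume_ge0.
  by apply: nneseries_lim_ge.
rewrite integral_nneseries//.
apply: nneseries_le => [k|K]; first exact: integral_ge0.
apply: (@le_trans _ _ (\sum_(k < K) (2 ^+ (2 * n).+1 * t^-1 * 2^-1 ^+ k)%:E * hlmax B x)%E).
  apply: lee_sum => k _; rewrite ge0_integralZl_EFin//.
  apply: (@le_trans _ _ ((w k)%:E * (((2 * (2 ^+ k * t)) ^+ n)%:E * hlmax B x))%E).
    apply: lee_wpmul2l; first by rewrite lee_fin.
    apply: le_trans (integral_ball_le_hlmax x B0 mB (h2 k)).
    rewrite [leRHS]integral_mkcond; apply: ge0_integral_mono => z _ //.
    by rewrite patchE indicE; case: ifP => _; rewrite ?mule1 ?mule0.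
  rewrite muleA -EFinM le_eqVlt; apply/orP; left; apply/eqP; congr (_%:E * _)%E.
  have -> : 2 ^+ (2 * n).+1 * t^-1 * 2^-1 ^+ k = 2 ^+ (2 * n).+1 * (2 ^+ k * t)^-1.
    by rewrite invfM exprVn; lra.
  rewrite /w; move: (2 ^+ k * t) (h2 k) => T T0.
  have e1 : T ^- n * T ^+ n = 1 by rewrite mulVf// expf_neq0// gt_eqF.
  rewrite exprMn [(2 * T) ^+ n]exprMn exprVn invfM invrK [T ^+ n.+1]exprS invfM.
  rewrite [LHS](_ : _ = 2 ^+ n * 2 ^+ n.+1 * T^-1 * (T ^- n * T ^+ n)); last by lra.
  by rewrite e1 mulr1 -exprD addnS mul2n addnn.
rewrite -ge0_sume_distrl; last first.
  by move=> k _; rewrite lee_fin !mulr_ge0 ?invr_ge0 ?exprn_ge0// ltW.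
apply: lee_wpmul2r; first exact: hlmax_ge0.
rewrite sumEFin lee_fin -mulr_sumr.
have := @sum_geometric_le R 2^-1 K ltac:(lra).
rewrite (_ : 1 - 2^-1 = 2^-1 :> R) ?invrK; last by lra.
have : 0 < 2 ^+ (2 * n).+1 * t^-1 by rewrite mulr_gt0 ?invr_gt0 ?exprn_gt0.
by rewrite [2 ^+ (2 * n).+2]exprS; move=> p0 le2; rewrite (le_trans (ler_wpM2l (ltW p0) le2))//; lra.
Qed.

End kernel.

(** * Schwartz functions and the nontangential maximal function *)

Section schwartz_functions.
Context {R : realType} {n : nat}.
Local Notation mu := (@lebesgue_rV R n).
Implicit Types (x y z c v : 'rV[R]_n) (phi : 'rV[R]_n -> R).

Lemma schwartz_seminorm_bound phi al l : schwartz phi ->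
  exists2 c : R, 0 <= c & forall x, `|monomial al x * partials l phi x| <= c.
Proof.
move=> [_ /(_ al l)]; set s := schwartz_seminorm _ _ _ => soo.
have h x : (`|monomial al x * partials l phi x|%:E <= s)%E by apply: ereal_sup_ubound; exists x.
have s0 : (0 <= s)%E by apply: le_trans (h 0); rewrite lee_fin.
have sf : s \is a fin_num by rewrite ge0_fin_numE.
exists (fine s); first exact: fine_ge0.
by move=> x; rewrite -lee_fin fineK.
Qed.

(** The seminorms for the monomials 1 and x_i^(N+1) suffice, because the sup
    norm of x equals some |x_i|. *)
Lemma schwartz_decay phi l N : schwartz phi ->
  exists2 C : R, 0 <= C & forall x, `|partials l phi x| <= C * (1 + `|x|) ^- N.+1.
Proof.
move=> sphi.
have [c0 c00 h0] := schwartz_seminorm_bound (fun=> 0%N) l sphi.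
have /choice[c hc] : forall i : 'I_n, exists c : R, 0 <= c /\ forall x,
    `|x 0 i| ^+ N.+1 * `|partials l phi x| <= c.
  move=> i; have [c c0' h] := schwartz_seminorm_bound (fun j => if j == i then N.+1 else 0%N) l sphi.
  exists c; split => // x; rewrite -normrX -normrM; apply: le_trans (h x).
  by rewrite /monomial (bigD1 i)//= eqxx big1 ?mulr1// => j /negbTE ->.
have cs0 : 0 <= \sum_i c i by apply: sumr_ge0 => i _; have [] := hc i.
exists (2 ^+ N.+1 * (c0 + \sum_i c i)); first by rewrite mulr_ge0 ?exprn_ge0 ?addr_ge0.
move=> x; have x0 := normr_ge0 x.
rewrite ler_pdivlMr; last by rewrite exprn_gt0//; lra.
rewrite [leLHS]mulrC.
have h0x : `|partials l phi x| <= c0.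
  apply: le_trans (h0 x); rewrite /monomial big1 ?mul1r// => i _; exact: expr0.
have [x1|x1] := leP `|x| 1.
  rewrite ler_pM ?exprn_ge0//.
    by rewrite lerXn2r ?nnegrE//; lra.
  by lra.
have [|i xi] := @mx_norm_neq0 _ _ _ x; first by apply/negP => /eqP h; move: x1; rewrite [`|x|]h ltr10.
have := (hc i.2).2 x.
have -> : `|x 0 i.2| = `|x| by rewrite [RHS]xi; case: i {xi} => i j /=; rewrite ord1.
move=> hx; apply: (@le_trans _ _ (2 ^+ N.+1 * (`|x| ^+ N.+1 * `|partials l phi x|))).
  rewrite mulrA -exprMn ler_wpM2r// lerXn2r ?nnegrE//; lra.
rewrite ler_wpM2l ?exprn_ge0// (le_trans hx)//.
rewrite (bigD1 i.2)//= addrCA lerDl addr_ge0// sumr_ge0// => j _; by have [] := hc j.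
Qed.

Lemma normr_derive_le phi x v : differentiable phi x ->
  `|'D_v phi x| <= `|v| * \sum_(i < n) `|partial i phi x|.
Proof.
move=> dphi; rewrite deriveE// {1}(row_sum_delta v) linear_sum.
rewrite mulr_sumr; apply: (le_trans (ler_norm_sum _ _ _)); apply: ler_sum => i _.
by rewrite linearZ /= normrM /partial deriveE// ler_wpM2r// normr_coord.
Qed.

Lemma segment_MVT phi c v : (forall x, differentiable phi x) ->
  exists2 th : R, 0 <= th <= 1 & phi (c + v) - phi c = 'D_v phi (c + th *: v).
Proof.
move=> dphi; pose g (th : R) := phi (c + th *: v).
have dg (th : R) : is_derive th (1 : R) g ('D_v phi (c + th *: v)).
  have E : (fun h : R => h^-1 *: ((g \o shift th) (h *: (1 : R)) - g th)) =
      (fun h => h^-1 *: ((phi \o shift (c + th *: v)) (h *: v) - phi (c + th *: v))).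
    apply/funext => h /=; rewrite /g; congr (_ *: (phi _ - _)).
    by rewrite scalerDl [h *: 1]mulr1 addrCA.
  have dv : derivable phi (c + th *: v) v by apply: diff_derivable.
  by split; rewrite /derivable /derive E.
have [|th] := @MVT_segment R g (fun th => 'D_v phi (c + th *: v)) 0 1 ler01 (fun th _ => dg th) _.
  apply: derivable_within_continuous => th _; by have [] := dg th.
rewrite in_itv/= => th01; rewrite subr0 mulr1 => hth.
by exists th => //; rewrite -hth /g scale1r scale0r addr0.
Qed.

Lemma schwartz_continuous phi : schwartz phi -> continuous phi.
Proof. by move=> [d _] x; apply: differentiable_continuous; exact: (d [::] x). Qed.

Lemma measurable_dilate phi t y : schwartz phi ->
  measurable_fun setT (fun z => dilate phi t (y - z)).
Proof.
move=> sphi; apply: measurable_funM => //; apply: continuous_measurable_rV => z.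
have h : {for z, continuous (fun z : 'rV[R]_n => t^-1 *: (y - z))}.
  by apply: continuousZl_tmp; apply: continuousB; [exact: cst_continuous|exact: cvg_id].
apply: (@continuous_comp _ _ _ _ phi z h); exact: schwartz_continuous sphi _.
Qed.

(** Since |x - y| < t, the quantities t + |y - z| and t + |x - z| are
    comparable: the nontangential approach costs only a constant. *)
Lemma dilate_size phi : schwartz phi -> exists2 C : R, 0 <= C &
  forall (t : R) x y z, 0 < t -> `|x - y| < t ->
    `|dilate phi t (y - z)| <= C * t * (t + `|x - z|) ^- n.+1.
Proof.
move=> sphi; have [C C0 hC] := schwartz_decay [::] n sphi.
exists (C * 2 ^+ n.+1) => [|t x y z t0 xyt]; first by rewrite mulr_ge0 ?exprn_ge0.
have tn : 0 < t ^+ n by rewrite exprn_gt0.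
rewrite /dilate normrM ger0_norm; last by rewrite invr_ge0 ltW.
apply: (@le_trans _ _ (t ^- n * (C * (1 + `|t^-1 *: (y - z)|) ^- n.+1))).
  by rewrite ler_wpM2l ?invr_ge0 ?(ltW tn)//; exact: hC.
have -> : 1 + `|t^-1 *: (y - z)| = t^-1 * (t + `|y - z|).
  by rewrite normrZ mulrDr mulVf ?gt_eqF// gtr0_norm ?invr_gt0.
have n0 := normr_ge0 (y - z); have n1 := normr_ge0 (x - z).
have s0 : 0 < t + `|y - z| by lra.
rewrite exprMn exprVn invfM invrK exprS.
have -> : t ^- n * (C * (t * t ^+ n * (t + `|y - z|) ^- n.+1)) =
   (t ^- n * t ^+ n) * (C * t * (t + `|y - z|) ^- n.+1) by lra.
rewrite mulVf ?gt_eqF// mul1r.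
have -> : C * 2 ^+ n.+1 * t * (t + `|x - z|) ^- n.+1 = C * t * (2 ^+ n.+1 * (t + `|x - z|) ^- n.+1) by lra.
apply: ler_wpM2l; first by rewrite mulr_ge0// ltW.
rewrite -[X in X * _]invrK -invfM -exprVn -exprMn lef_pV2 ?posrE ?exprn_gt0//; last by lra.
rewrite lerXn2r ?nnegrE//; try lra.
have := ler_distD y x z; lra.
Qed.

(** Mean value theorem on the segment from x0 to z: the gradient of phi_t
    contributes t^-(n+1) (1 + |y - xi| / t)^-(n+1) = (t + |y - xi|)^-(n+1),
    and t + |y - xi| >= |x - xi| >= |x - x0| - l since |x - y| < t. *)
Lemma dilate_smooth phi : schwartz phi -> exists2 C : R, 0 <= C &
  forall (t l : R) x y z x0, 0 < t -> 0 < l -> `|x - y| < t -> `|z - x0| <= l ->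
    2 * l < `|x - x0| ->
    `|dilate phi t (y - z) - dilate phi t (y - x0)| <= C * l * (l + `|x - x0|) ^- n.+1.
Proof.
move=> sphi; have /choice[C hC] : forall i : 'I_n, exists C : R, 0 <= C /\
    forall x, `|partial i phi x| <= C * (1 + `|x|) ^- n.+1.
  by move=> i; have [C C0 h] := schwartz_decay [:: i] n sphi; exists C.
have Cs0 : 0 <= \sum_i C i by apply: sumr_ge0 => i _; have [] := hC i.
exists (3 ^+ n.+1 * \sum_i C i); first by rewrite mulr_ge0 ?exprn_ge0.
move=> t l x y z x0 t0 l0 xyt zl xl.
have tn : 0 < t ^+ n by rewrite exprn_gt0.
rewrite /dilate -mulrBr normrM ger0_norm; last by rewrite invr_ge0 ltW.
have [|th th01] := @segment_MVT phi (t^-1 *: (y - x0)) (- (t^-1 *: (z - x0))).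
  by move=> w; exact: (sphi.1 [::] w).
rewrite -scalerBr opprB addrA subrK => ->.
set w := _ + th *: _.
have wE : w = t^-1 *: (y - (x0 + th *: (z - x0))).
  by rewrite /w scalerN (scalerA th) mulrC -scalerA -scalerBr opprD addrA.
apply: (@le_trans _ _ (t ^- n * (t^-1 * l * (\sum_i C i * (1 + `|w|) ^- n.+1)))).
  rewrite ler_wpM2l ?invr_ge0 ?(ltW tn)//.
  apply: (le_trans (normr_derive_le _ _)); first exact: (sphi.1 [::] w).
  apply: ler_pM => //; first exact: sumr_ge0.
    by rewrite normrN normrZ gtr0_norm ?invr_gt0// ler_wpM2l// invr_ge0 ltW.
  by apply: ler_sum => i _; have [_ ->] := hC i.
rewrite -mulr_suml.
have -> : 1 + `|w| = t^-1 * (t + `|y - (x0 + th *: (z - x0))|).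
  by rewrite wE normrZ mulrDr mulVf ?gt_eqF// gtr0_norm ?invr_gt0.
set xi := x0 + _.
have n0 := normr_ge0 (y - xi).
have s0 : 0 < t + `|y - xi| by lra.
rewrite exprMn exprVn invfM invrK exprS.
have -> : t ^- n * (t^-1 * l * ((\sum_i C i) * (t * t ^+ n * (t + `|y - xi|) ^- n.+1))) =
   (t ^- n * t ^+ n) * (t^-1 * t) * (l * (\sum_i C i) * (t + `|y - xi|) ^- n.+1) by lra.
rewrite !mulVf ?gt_eqF// !mul1r.
have -> : 3 ^+ n.+1 * (\sum_i C i) * l * (l + `|x - x0|) ^- n.+1 =
   l * (\sum_i C i) * (3 ^+ n.+1 * (l + `|x - x0|) ^- n.+1) by lra.
apply: ler_wpM2l; first by rewrite mulr_ge0// ltW.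
have n1 := normr_ge0 (x - x0).
rewrite -[X in X * _]invrK -invfM -exprVn -exprMn lef_pV2 ?posrE ?exprn_gt0//; last by lra.
have x0xi : `|xi - x0| <= l.
  rewrite /xi addrC addKr normrZ; apply: le_trans zl.
  by rewrite -[leRHS]mul1r ler_wpM2r// ger0_norm; case/andP: th01.
rewrite lerXn2r ?nnegrE//; try lra.
have := ler_distD y x xi; have := ler_distD xi x x0; lra.
Qed.

End schwartz_functions.

Section nontangential.
Context {R : realType} {n : nat}.
Local Notation mu := (@lebesgue_rV R n).
Implicit Types (x y z c v : 'rV[R]_n) (phi : 'rV[R]_n -> R).

Lemma normr_le_euclidean x : `|x| <= euclidean_norm x.
Proof.
apply: normr_rV_le; first exact: sqrtr_ge0.
move=> i; rewrite -sqrtr_sqr ler_wsqrtr// (bigD1 i)//= lerDl sumr_ge0// => j _.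
exact: sqr_ge0.
Qed.

Lemma nontangential_max_ge0 phi u x : (0 <= nontangential_max phi u x)%E.
Proof.
apply: le_ereal_sup_tmp; exists (`|convolve u (dilate phi 1) x|%:E); last by rewrite lee_fin.
exists (x, 1) => //=; rewrite subrr /euclidean_norm big1 ?sqrtr0// => i _.
by rewrite mxE expr0n.
Qed.

Lemma nontangential_max_le phi u x (c : \bar R) :
  (forall y t, 0 < t -> `|x - y| < t ->
     (`|convolve u (dilate phi t) y|%:E <= c)%E) ->
  (nontangential_max phi u x <= c)%E.
Proof.
move=> h; apply: ge_ereal_sup => _ [[y t] /= xyt <-].
have e := normr_le_euclidean (x - y); have n0 := normr_ge0 (x - y).
by apply: h; lra.
Qed.

(** A point (y, t) of the cone above x also belongs to the cone above every
    point close to x. *)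
Lemma nontangential_max_lsc phi u (a : R) :
  open [set x | (a%:E < nontangential_max phi u x)%E].
Proof.
rewrite openE => x /= /ereal_sup_gt[_ [[y t] /= xyt <-] ak].
have c1 i : continuous (fun x' : 'rV[R]_n => (x' 0 i - y 0 i) ^+ 2).
  have h : continuous (fun x' : 'rV[R]_n => x' 0 i - y 0 i).
    by move=> w; apply: continuousB; [exact: coord_continuous|exact: cst_continuous].
  move=> w; exact: (continuous_comp (h w) (@exprn_continuous _ 2 _)).
have c2 : continuous (fun x' : 'rV[R]_n => \sum_i (x' 0 i - y 0 i) ^+ 2).
  by apply: continuous_big => //; exact: add_continuous.
have ce : {for x, continuous (fun x' => euclidean_norm (x' - y))}.
  rewrite (_ : (fun x' => _) = Num.sqrt \o (fun x' : 'rV[R]_n => \sum_i (x' 0 i - y 0 i) ^+ 2)).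
    by apply: continuous_comp; [exact: c2|exact: sqrt_continuous].
  apply/funext => w /=; rewrite /euclidean_norm; congr Num.sqrt.
  by apply: eq_bigr => i _; rewrite !mxE.
have : \forall x' \near x, euclidean_norm (x' - y) < t.
  exact: (cvgr_lt _ ce).
apply: filterS => x' x'yt; apply: (lt_le_trans ak).
by apply: ereal_sup_ubound; exists (y, t).
Qed.

Lemma measurable_nontangential_max phi u :
  measurable_fun setT (nontangential_max phi u : 'rV[R]_n -> \bar R).
Proof. by apply: lsc_measurable_rV => a; exact: nontangential_max_lsc. Qed.

End nontangential.

(** * Size estimates for atoms *)

Section integration_facts.
Context d (T : measurableType d) {R : realType}.
Variable mu : {measure set T -> \bar R}.
Implicit Types (f g : T -> R).

Lemma normr_Rintegral_le f : measurable_fun setT f ->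
  (`|\int[mu]_x f x|%:E <= \int[mu]_x `|f x|%:E)%E.
Proof.
move=> mf; apply: (@le_trans _ _ `|\int[mu]_x (f x)%:E|%E).
  rewrite /Rintegral; case: (integral _ _ _) => [r| |] //=; first by rewrite normr0 leey.
  by rewrite normr0 leey.
by apply: (le_trans (le_abse_integral _ _ _)) => //; exact/measurable_EFinP.
Qed.

Lemma integrable_mul_bounded f g (M : R) : mu.-integrable setT (EFin \o f) ->
  measurable_fun setT g -> (forall x, `|g x| <= M) ->
  mu.-integrable setT (EFin \o (fun x => f x * g x)).
Proof.
move=> intf mg gM; have mf : measurable_fun setT f by move/integrableP : intf => [/measurable_EFinP].
have iM : mu.-integrable setT (fun x => (M%:E * (EFin \o f) x)%E) by exact: integrableZl.
apply: le_integrable iM => //.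
  by apply/measurable_EFinP; exact: measurable_funM.
move=> x _ /=; rewrite lee_fin !normrM mulrC ler_wpM2r//.
by rewrite (le_trans (gM x))// ler_norm.
Qed.

Lemma integrable_of_lt_pinfty f : measurable_fun setT f ->
  (\int[mu]_x `|f x|%:E < +oo)%E -> mu.-integrable setT (EFin \o f).
Proof. by move=> mf h; apply/integrableP; split => //; exact/measurable_EFinP. Qed.

End integration_facts.

Section atoms.
Context {R : realType} {n : nat}.
Local Notation mu := (@lebesgue_rV R n).
Implicit Types (x y z : 'rV[R]_n) (phi a : 'rV[R]_n -> R).

Lemma schwartz_bounded phi : schwartz phi ->
  exists2 C : R, 0 <= C & forall x, `|phi x| <= C.
Proof.
move=> sphi; have [C C0 hC] := schwartz_decay [::] 0 sphi; exists C => // x.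
apply: (le_trans (hC x)); have := normr_ge0 x => x0.
rewrite expr1 ler_pdivrMr; last by lra.
by rewrite ler_peMr//; lra.
Qed.

Lemma dilate_bounded phi t y : schwartz phi ->
  exists2 C : R, 0 <= C & forall z, `|dilate phi t (y - z)| <= C.
Proof.
move=> /schwartz_bounded[C C0 hC]; exists (`|t ^- n| * C); first by rewrite mulr_ge0.
by move=> z; rewrite normrM ler_wpM2l.
Qed.

Lemma measurable_decay (t : R) x : 0 < t ->
  measurable_fun setT (fun z => (t + `|x - z|) ^- n.+1).
Proof.
move=> t0; apply: continuous_measurable_rV => z.
have h : {for z, continuous (fun z : 'rV[R]_n => t + `|x - z|)}.
  apply: continuousD; first exact: cst_continuous.
  have h1 : {for z, continuous (fun z : 'rV[R]_n => x - z)}.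
    by apply: continuousB; [exact: cst_continuous|exact: cvg_id].
  exact: (continuous_comp h1 (@norm_continuous _ _ _)).
have h2 := continuous_comp h (@exprn_continuous R n.+1 _).
apply: (continuousV _ h2) => /=.
by rewrite expf_neq0// gt_eqF// ltr_pwDl.
Qed.

(** Combines [dilate_size] with [integral_decay_le]. *)
Lemma integral_dilate_le phi : schwartz phi -> exists2 C : R, 0 <= C &
  forall (B : 'rV[R]_n -> \bar R) x y t, (forall z, 0 <= B z)%E ->
    measurable_fun setT B -> 0 < t -> `|x - y| < t ->
    (\int[mu]_z (B z * `|dilate phi t (y - z)|%:E) <= C%:E * hlmax B x)%E.
Proof.
move=> sphi; have [C C0 hC] := dilate_size sphi.
exists (C * 2 ^+ (2 * n).+2) => [|B x y t B0 mB t0 xyt]; first by rewrite mulr_ge0 ?exprn_ge0.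
have mk : measurable_fun setT (fun z => (B z * ((t + `|x - z|) ^- n.+1)%:E)%E).
  apply: emeasurable_funM => //; apply/measurable_EFinP; exact: measurable_decay.
apply: (@le_trans _ _ (\int[mu]_z ((C * t)%:E * (B z * ((t + `|x - z|) ^- n.+1)%:E)))%E).
  apply: ge0_integral_mono => z _; first by rewrite mule_ge0// lee_fin.
  by rewrite muleCA; apply: lee_wpmul2l => //; rewrite -EFinM lee_fin; exact: hC.
rewrite ge0_integralZl_EFin//; last 2 first.
- by move=> z _; rewrite mule_ge0// lee_fin invr_ge0 exprn_ge0// addr_ge0// ltW.
- by rewrite mulr_ge0// ltW.
apply: (@le_trans _ _ ((C * t)%:E * ((2 ^+ (2 * n).+2 * t^-1)%:E * hlmax B x))%E).
  by apply: lee_wpmul2l; [rewrite lee_fin mulr_ge0// ltW|exact: integral_decay_le].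
rewrite muleA -EFinM (_ : C * t * _ = C * 2 ^+ (2 * n).+2 * (t * t^-1)); last by lra.
by rewrite mulfV ?mulr1// gt_eqF.
Qed.

Lemma measurable_cube (x0 : 'rV[R]_n) l : measurable (cube x0 l).
Proof.
have -> : cube x0 l = \bigcap_(i in [set: 'I_n]) (fun x => x 0 i) @^-1` `[x0 0 i, x0 0 i + l].
  apply/seteqP; split => x h i; first by move=> _ /=; rewrite in_itv/=; exact: h.
  by have := h i I; rewrite /= in_itv/=.
apply: fin_bigcap_measurable => // i _.
by rewrite -[X in measurable X]setTI; exact: measurable_rV_coord.
Qed.

Lemma lebesgue_cube (x0 : 'rV[R]_n) l : 0 < l -> mu (cube x0 l) = (l ^+ n)%:E.
Proof.
move=> l0; have -> : cube x0 l = [set x | forall i, x0 0 i <= x 0 i <= (\row_j (x0 0 j + l)) 0 i].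
  by apply/seteqP; split => x h i; have := h i; rewrite mxE.
rewrite lebesgue_rV_box; last by move=> i; rewrite mxE lerDl ltW.
congr EFin; rewrite (eq_bigr (fun=> l)); last by move=> i _; rewrite mxE addrC addKr.
by rewrite prodr_const card_ord.
Qed.

(** The normalisation of an atom, solved for the integral of |a|^q. *)
Lemma atom_Lq p q s x0 l a : 1 < q -> q <= 2 -> p^-1 + q^-1 = 1 -> 0 < l ->
  is_atom_on p q s%:E (cube x0 l) a -> 0 < s ->
  [/\ forall z, ~ cube x0 l z -> a z = 0,
      (\int[mu]_z (`|a z| `^ q)%:E <= ((p `^ (- s^-1) / l ^+ n) `^ q * l ^+ n)%:E)%E &
      (\int[mu]_z (a z)%:E = 0)%E].
Proof.
move=> q1 q2 pq l0 [ma sa a0 aq] s0.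
have aout z : ~ cube x0 l z -> a z = 0.
  move=> nz; apply/eqP; apply: contrapT => /negP az.
  by apply: nz; apply: sa; exact: subset_closure.
have p0 : 0 < p by have := conjugate_ge2 q1 q2 pq; lra.
have ln0 : 0 < l ^+ n by rewrite exprn_gt0.
have q0 : q != 0 by rewrite gt_eqF; lra.
split => //; last first.
  rewrite -[RHS]a0 [RHS]integral_mkcond; apply: eq_integral => z _.
  by rewrite patchE; case: ifPn => // /negP; rewrite inE => /aout ->.
have -> : (\int[mu]_z (`|a z| `^ q)%:E = \int[mu]_(z in cube x0 l) (`|a z| `^ q)%:E)%E.
  rewrite [RHS]integral_mkcond; apply: eq_integral => z _.
  rewrite patchE; case: ifPn => // /negP; rewrite inE => /aout ->.
  by rewrite normr0 powR0.
move: aq; rewrite lebesgue_cube//.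
have I0 : (0 <= \int[mu]_(z in cube x0 l) (`|a z| `^ q)%:E)%E.
  by apply: integral_ge0 => z _; rewrite lee_fin powR_ge0.
have ps : 0 < p `^ s^-1 by rewrite powR_gt0.
have sf : fine (s%:E^-1)%E = s^-1 by rewrite inver gt_eqF.
rewrite sf inver (gt_eqF ln0).
case: (integral _ _ _) I0 => [I| |//] I0.
  rewrite -(EFinM (l ^- n) I) poweR_EFin -!EFinM !lee_fin => h.
  have I0' : 0 <= I by [].
  rewrite -ler_pdivrMr// [leLHS]mulrC.
  have -> : (l ^+ n)^-1 * I = ((((l ^+ n)^-1 * I) `^ q^-1) `^ q).
    by rewrite -powRrM mulVf// powRr1// mulr_ge0// invr_ge0 ltW.
  rewrite ge0_ler_powR ?nnegrE ?powR_ge0//.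
  - by lra.
  - by rewrite divr_ge0 ?powR_ge0// ltW.
  - rewrite powRN -invfM -[leRHS]mul1r ler_pdivlMr; last by rewrite mulr_gt0.
    by rewrite mulrC.
rewrite gt0_muley ?lte_fin ?invr_gt0// poweRyr ?invr_eq0//.
by rewrite -EFinM gt0_muley ?lte_fin ?mulr_gt0// leye_eq.
Qed.

(** Pointwise |a| <= A + A^(1-q) |a|^q on the cube, with A the bound on the
    L^q average of a; both terms integrate to at most A |Q|. *)
Lemma atom_L1 p q s x0 l a : 1 < q -> q <= 2 -> p^-1 + q^-1 = 1 -> 0 < l ->
  is_atom_on p q s%:E (cube x0 l) a -> 0 < s ->
  (\int[mu]_z `|a z|%:E <= (2 * p `^ (- s^-1))%:E)%E.
Proof.
move=> q1 q2 pq l0 at_a s0; have [ma _ _ _] := at_a.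
have [aout aq _] := atom_Lq q1 q2 pq l0 at_a s0.
have p0 : 0 < p by have := conjugate_ge2 q1 q2 pq; lra.
have ln0 : 0 < l ^+ n by rewrite exprn_gt0.
set A := p `^ (- s^-1) / l ^+ n in aq.
have A0 : 0 < A by rewrite divr_gt0// powR_gt0.
have Aq : 0 < A `^ (q - 1) by rewrite powR_gt0.
apply: (@le_trans _ _ (\int[mu]_z ((A * \1_(cube x0 l) z)%:E + ((A `^ (q - 1))^-1)%:E * (`|a z| `^ q)%:E))%E).
  apply: ge0_integral_mono => z _; first by rewrite lee_fin.
  rewrite -EFinM -EFinD lee_fin indicE.
  have [az|az] := leP `|a z| A.
    have [zQ|/negP] := boolP (z \in cube x0 l).
      by rewrite mulr1 (le_trans az)// lerDl mulr_ge0 ?invr_ge0 ?powR_ge0.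
    by rewrite inE => /aout ->; rewrite normr0 addr_ge0// ?mulr0// mulr_ge0 ?invr_ge0 ?powR_ge0.
  rewrite (@le_trans _ _ ((A `^ (q - 1))^-1 * `|a z| `^ q))//; last first.
    by rewrite lerDr mulr_ge0// ltW.
  rewrite mulrC ler_pdivlMr//.
  rewrite -(@mulr_powRB1 _ `|a z|)//; last by lra.
  by rewrite ler_wpM2l// ge0_ler_powR ?nnegrE ?subr_ge0// ltW.
have mq : measurable_fun setT (fun z => (`|a z| `^ q)%:E).
  apply/measurable_EFinP; apply: (measurableT_comp (measurable_powR q)).
  exact: measurableT_comp.
have mi : measurable_fun setT (\1_(cube x0 l) : 'rV[R]_n -> R).
  by apply: measurable_indic; exact: measurable_cube.
rewrite ge0_integralD//; last 4 first.
- by move=> z _; rewrite lee_fin mulr_ge0// ltW.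
- by apply/measurable_EFinP; exact: measurable_funM.
- by move=> z _; rewrite mule_ge0// lee_fin ?powR_ge0// invr_ge0 ltW.
- exact: measurable_funeM.
have -> : (\int[mu]_z (A * \1_(cube x0 l) z)%:E = (A * l ^+ n)%:E)%E.
  under eq_integral do rewrite EFinM.
  rewrite ge0_integralZl_EFin;
    [|exact: measurableT|by move=> z _; rewrite lee_fin|exact/measurable_EFinP|exact: ltW].
  rewrite integral_indic//; last exact: measurable_cube.
  by rewrite setIT [X in (_ * X)%E](lebesgue_cube x0 l0).
rewrite ge0_integralZl_EFin//; last by rewrite invr_ge0 ltW.
apply: (@le_trans _ _ ((A * l ^+ n)%:E + ((A `^ (q - 1))^-1)%:E * (A `^ q * l ^+ n)%:E)%E).
  by rewrite leeD2l//; apply: lee_wpmul2l aq; rewrite lee_fin invr_ge0 ltW.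
rewrite -EFinM -EFinD lee_fin.
have -> : A `^ q = A * A `^ (q - 1) by rewrite mulr_powRB1 ?(ltW A0)//; lra.
rewrite (_ : _^-1 * _ = ((A `^ (q - 1))^-1 * A `^ (q - 1)) * (A * l ^+ n)); last by lra.
rewrite mulVf ?gt_eqF// mul1r /A mulfVK ?gt_eqF//; lra.
Qed.

End atoms.

(** * The nontangential maximal function of an atom *)

Section atom_maximal.
Context {R : realType} {n : nat}.
Local Notation mu := (@lebesgue_rV R n).
Implicit Types (x y z : 'rV[R]_n) (phi a f : 'rV[R]_n -> R).

Lemma convolve_le phi f t y : schwartz phi -> measurable_fun setT f ->
  (`|convolve (distribution_of f) (dilate phi t) y|%:E <=
     \int[mu]_z (`|f z|%:E * `|dilate phi t (y - z)|%:E))%E.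
Proof.
move=> sphi mf; have mg := measurable_dilate t y sphi.
apply: (le_trans (normr_Rintegral_le _ _)); first exact: measurable_funM.
by under eq_integral do rewrite normrM EFinM.
Qed.

Lemma nontangential_max_le_hlmax phi : schwartz phi -> exists2 C : R, 0 <= C &
  forall f x, measurable_fun setT f ->
    (nontangential_max phi (distribution_of f) x <=
      C%:E * hlmax (fun z => `|f z|%:E) x)%E.
Proof.
move=> sphi; have [C C0 hC] := integral_dilate_le sphi; exists C => // f x mf.
apply: nontangential_max_le => y t t0 xyt; apply: (le_trans (convolve_le _ _ sphi mf)).
apply: hC => //.
by apply/measurable_EFinP; exact: measurableT_comp.
Qed.

Lemma normr_cube_corner (x0 z : 'rV[R]_n) l : 0 < l -> cube x0 l z -> `|z - x0| <= l.
Proof.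
move=> l0 zQ; apply: normr_rV_le; first exact: ltW.
by move=> i; have := zQ i; rewrite !mxE => zi; rewrite ger0_norm; lra.
Qed.

(** As a has integral zero, phi_t(y - z) may be replaced with phi_t(y - z) -
    phi_t(y - x0) in the convolution. *)
Lemma nontangential_max_tail phi : schwartz phi -> exists2 C : R, 0 <= C &
  forall a x0 l x, 0 < l -> measurable_fun setT a ->
    (forall z, ~ cube x0 l z -> a z = 0) -> (\int[mu]_z `|a z|%:E < +oo)%E ->
    (\int[mu]_z (a z)%:E = 0)%E -> 2 * l < `|x - x0| ->
    (nontangential_max phi (distribution_of a) x <=
      (C * l * (l + `|x - x0|) ^- n.+1)%:E * \int[mu]_z `|a z|%:E)%E.
Proof.
move=> sphi; have [C C0 hC] := dilate_smooth sphi; exists C => // a x0 l x l0 ma aout aint a0 xx0.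
have ia := integrable_of_lt_pinfty ma aint.
apply: nontangential_max_le => y t t0 xyt.
have mg := measurable_dilate t y sphi; have [M M0 hM] := dilate_bounded t y sphi.
have iag := integrable_mul_bounded ia mg hM.
set K := dilate phi t (y - x0).
have iaK : mu.-integrable setT (EFin \o (fun z => a z * K)).
  by apply: (@integrable_mul_bounded _ _ _ mu a (fun=> K) `|K|).
have -> : convolve (distribution_of a) (dilate phi t) y =
    \int[mu]_z (a z * (dilate phi t (y - z) - K)).
  rewrite /convolve /distribution_of.
  under [RHS]eq_Rintegral do rewrite mulrBr.
  rewrite RintegralB// RintegralZr//.
  by rewrite [X in _ - X * _](_ : _ = 0) ?mul0r ?subr0// /Rintegral a0.
apply: (le_trans (normr_Rintegral_le _ _)).
  by apply: measurable_funM => //; exact: measurable_funB.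
rewrite -ge0_integralZl_EFin//; last 2 first.
- by apply/measurable_EFinP; exact: measurableT_comp.
- by rewrite !mulr_ge0 ?invr_ge0 ?exprn_ge0 ?addr_ge0// ltW.
apply: ge0_integral_mono => z _; first by rewrite lee_fin.
rewrite -EFinM lee_fin normrM mulrC.
have [zQ|nzQ] := pselect (cube x0 l z); last by rewrite aout// normr0 !mulr0.
by rewrite ler_wpM2r//; apply: hC => //; exact: normr_cube_corner.
Qed.

(** Inside a ball of radius 3 l around the corner of the cube, the local
    estimate gives the factor p; outside, the tail decays like |x - x0|^-(n+1)
    and contributes a multiple of the L^1 norm of a, smaller by a factor p. *)
Lemma integral_atom_nontangential phi : schwartz phi -> exists2 C : R, 0 <= C &
  forall p q s x0 l a, 1 < q -> q <= 2 -> p^-1 + q^-1 = 1 -> 0 < l -> 0 < s ->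
    is_atom_on p q s%:E (cube x0 l) a ->
    (\int[mu]_x nontangential_max phi (distribution_of a) x <=
      (C * (p * p `^ (- s^-1)))%:E)%E.
Proof.
move=> sphi; have [C1 C10 hC1] := nontangential_max_le_hlmax sphi.
have [C2 C20 hC2] := nontangential_max_tail sphi.
pose D1 := C1 * (2 ^+ n.+1 * (6 ^+ n + 3 ^+ n * 3)).
pose D2 := C2 * 2 * 2 ^+ (2 * n).+2 * 2 ^+ n.
exists (D1 + D2) => [|p q s x0 l a q1 q2 pq l0 s0 at_a].
  apply: addr_ge0; rewrite /D1 /D2; do ?[exact: ler0n| exact: C10 | exact: C20| apply: exprn_ge0 | apply: mulr_ge0 | apply: addr_ge0].
have [ma _ _ _] := at_a.
have [aout aq a0] := atom_Lq q1 q2 pq l0 at_a s0.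
have a1 := atom_L1 q1 q2 pq l0 at_a s0.
have aoo : (\int[mu]_z `|a z|%:E < +oo)%E by apply: le_lt_trans a1 _; rewrite ltry.
have p1 : 1 <= p by have := conjugate_ge2 q1 q2 pq; lra.
have ln0 : 0 < l ^+ n by rewrite exprn_gt0.
set N := nontangential_max phi (distribution_of a).
have mN : measurable_fun setT N by exact: measurable_nontangential_max.
have N0 x : (0 <= N x)%E by exact: nontangential_max_ge0.
pose E := ball x0 (3 * l); have mE : measurable E by exact: measurable_ball_rV.
set ps := p `^ (- s^-1) in aq a1 *.
have ps0 : 0 < ps by rewrite powR_gt0; lra.
rewrite -(setUv E) ge0_integral_setU//; last 3 first.
- exact: measurableC.
- by rewrite setUv.
- by apply/disj_setPCl.
have -> : (D1 + D2) * (p * ps) = D1 * (p * ps) + D2 * (p * ps) by lra.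
rewrite EFinD; apply: leeD.
- apply: (@le_trans _ _ (\int[mu]_(x in E) (C1%:E * hlmax (fun z => `|a z|%:E) x))%E).
    by apply: ge0_integral_mono => x _ //; exact: hC1.
  rewrite ge0_integralZl_EFin//; last 2 first.
  + by move=> x _; apply: hlmax_ge0 => z; rewrite lee_fin.
  + by apply: measurable_funTS; exact: measurable_hlmax.
  have A0 : 0 < ps / l ^+ n by rewrite divr_gt0.
  apply: (@le_trans _ _ (C1%:E * ((2 ^+ n.+1 * (ps / l ^+ n))%:E * (mu E + (3 ^+ n * l ^+ n * (3 * p))%:E)))%E).
    by apply: lee_wpmul2l => //; apply: integral_hlmax_le aq => //; exact: ltW.
  have AA0 : 0 <= 2 ^+ n.+1 * (ps / l ^+ n) by rewrite mulr_ge0 ?exprn_ge0// ltW.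
  apply: (@le_trans _ _ (C1%:E * ((2 ^+ n.+1 * (ps / l ^+ n))%:E * ((6 ^+ n * l ^+ n)%:E + (3 ^+ n * l ^+ n * (3 * p))%:E)))%E).
    apply: lee_wpmul2l => //; apply: lee_wpmul2l; first by rewrite lee_fin.
    rewrite leeD2r//; apply: (le_trans (lebesgue_ball_le _ _)); first by lra.
    by rewrite mulrA exprMn (_ : 2 * 3 = 6)//; lra.
  rewrite -EFinD -!EFinM lee_fin /D1 -[leRHS]mulrA ler_wpM2l//.
  rewrite [leLHS](_ : _ = 2 ^+ n.+1 * (ps * (6 ^+ n + 3 ^+ n * 3 * p)) * ((l ^+ n)^-1 * l ^+ n)); last by lra.
  rewrite mulVf ?gt_eqF// mulr1 -[leRHS]mulrA ler_wpM2l ?exprn_ge0//.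
  rewrite [leRHS](_ : _ = ps * (6 ^+ n * p + 3 ^+ n * 3 * p)); last by lra.
  rewrite ler_wpM2l ?(ltW ps0)// lerD2r ler_peMr// exprn_ge0.
- apply: (@le_trans _ _ (\int[mu]_x ((C2 * l * (2 * ps))%:E * (1%:E * ((l + `|x0 - x|) ^- n.+1)%:E)))%E).
    rewrite integral_mkcond; apply: ge0_integral_mono => x _; first exact: erestrict_ge0.
    have d0 : 0 <= (l + `|x0 - x|) ^- n.+1 by rewrite invr_ge0 exprn_ge0// addr_ge0// ltW.
    have g0 : (0 <= (C2 * l * (2 * ps))%:E * (1%:E * ((l + `|x0 - x|) ^- n.+1)%:E))%E.
      by rewrite mul1e -EFinM lee_fin !mulr_ge0// ltW.
    rewrite patchE; case: ifPn => // /set_mem xE.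
    have xx0 : 2 * l < `|x - x0|.
      rewrite distrC ltNge; apply/negP => h; apply: xE; apply/in_ball; lra.
    apply: (le_trans (hC2 _ _ _ _ l0 ma aout aoo a0 xx0)).
    rewrite mul1e -EFinM (distrC x0).
    apply: (@le_trans _ _ ((C2 * l * (l + `|x - x0|) ^- n.+1)%:E * (2 * ps)%:E)%E).
      by apply: lee_wpmul2l => //; rewrite lee_fin !mulr_ge0 ?(ltW l0)// distrC.
    by rewrite -EFinM lee_fin le_eqVlt; apply/orP; left; apply/eqP; lra.
  have cs : measurable_fun setT (fun z : 'rV[R]_n => (1%:E * ((l + `|x0 - z|) ^- n.+1)%:E)%E).
    apply: emeasurable_funM => //; apply/measurable_EFinP.
    exact: measurable_decay.
  rewrite ge0_integralZl_EFin//; last 2 first.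
  + by move=> x _; rewrite mul1e lee_fin invr_ge0 exprn_ge0// addr_ge0// ltW.
  + by rewrite !mulr_ge0// ltW.
  have C2l : 0 <= C2 * l * (2 * ps) by rewrite !mulr_ge0// ltW.
  apply: (@le_trans _ _ ((C2 * l * (2 * ps))%:E * ((2 ^+ (2 * n).+2 * l^-1)%:E * (2 ^+ n * 1)%:E))%E).
    apply: lee_wpmul2l; first by rewrite lee_fin.
    apply: (le_trans (@integral_decay_le _ _ (fun=> 1%:E) x0 l _ _ l0)) => //.
    by apply: lee_wpmul2l; [rewrite lee_fin mulr_ge0 ?exprn_ge0// invr_ge0 ltW|exact: hlmax_cst].
  rewrite -!EFinM lee_fin /D2.
  rewrite [leLHS](_ : _ = C2 * 2 * 2 ^+ (2 * n).+2 * 2 ^+ n * ps * (l * l^-1)); last by lra.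
  rewrite mulfV ?gt_eqF// mulr1 [leRHS](_ : _ = C2 * 2 * 2 ^+ (2 * n).+2 * 2 ^+ n * ps * p); last by lra.
  rewrite ler_peMr//; do ?[exact: ler0n| exact: C20| exact: ltW | apply: exprn_ge0 | apply: mulr_ge0].
Qed.

End atom_maximal.

(** * From weak l^s to l^r, and from dyadic sums to the Lorentz norm *)

Section sequences.
Context {R : realType}.

(** Compares v with the dyadic levels 2^-m: if 2^-(m+1) < v <= 2^-m then the
    mth term alone is at least v^r; the last summand takes care of v <= 2^-M. *)
Lemma powR_level_sum (v r : R) M : 0 <= v <= 1 -> 0 < r ->
  v `^ r <= \sum_(m < M) (2 `^ (- r)) ^+ m * (2 ^- m.+1 < v)%R%:R + (2 `^ (- r)) ^+ M.
Proof.
move=> /andP[v0 v1] r0.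
have x0 : 0 < 2 `^ (- r) :> R by rewrite powR_gt0.
have pM k : (2 ^- k) `^ r = (2 `^ (- r)) ^+ k :> R.
  elim: k => [|k ih]; first by rewrite !expr0 invr1 powR1.
  by rewrite !exprS invfM powRM ?invr_ge0 ?exprn_ge0// ih -powR_inv1// -powRrM mulN1r.
elim: M => [|M ih].
  have e1 : 1 = 1 `^ r :> R by rewrite powR1.
  by rewrite big_ord0 add0r expr0 [leRHS]e1 ge0_ler_powR ?nnegrE// ltW.
rewrite big_ord_recr/=; have [h|h] := ltP (2 ^- M.+1) v.
  rewrite mulr1; apply: (le_trans ih); rewrite lerDl exprn_ge0// ltW.
rewrite mulr0 addr0 -pM; apply: (@le_trans _ _ ((2 ^- M.+1) `^ r)).
  by rewrite ge0_ler_powR ?nnegrE ?invr_ge0 ?exprn_ge0// ltW.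
rewrite lerDr sumr_ge0// => i _; rewrite mulr_ge0// exprn_ge0// ltW.
Qed.

(** The hypothesis is a bound on a K-functional between l^oo and l^1; it
    places u in weak l^s by counting, for each m, the indices with u_j > 2 C1
    L 2^-(m+1), where w_j exceeds half of u_j.  Weak l^s and l^oo embed in l^r
    for r > s by summing over the levels. *)
Lemma real_interpolation_sum (J : nat) (u : 'I_J -> R) (C1 C2 L s r : R) :
  0 < C1 -> 0 <= C2 -> 0 < L -> 1 < s -> s < r ->
  (forall j, 0 <= u j <= C1 * L) ->
  (forall m : nat, exists w : 'I_J -> R, [/\ forall j, 0 <= w j,
      forall j, u j <= C1 * 2 ^- m * L + w j &
      \sum_j w j <= C2 * (2 `^ (s - 1)) ^+ m * L]) ->
  \sum_j u j `^ r <=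
    (2 * C1 * L) `^ r * (1 + C2 / C1 * 2 `^ s * (1 - 2 `^ (- (r - s)))^-1).
Proof.
move=> C10 C20 L0 s1 sr u0 hw.
have CL0 : 0 < 2 * C1 * L by rewrite !mulr_gt0.
pose v j := u j / (2 * C1 * L).
have v01 j : 0 <= v j <= 1.
  have /andP[uj0 uj1] := u0 j.
  rewrite divr_ge0//=; last exact: ltW.
  by rewrite ler_pdivrMr// mul1r; nra.
have uv j : u j `^ r = (2 * C1 * L) `^ r * v j `^ r.
  rewrite -powRM ?(ltW CL0)//; last by case/andP: (v01 j).
  by rewrite mulrC /v divfK ?gt_eqF.
rewrite (eq_bigr _ (fun j _ => uv j)) -mulr_sumr ler_wpM2l ?powR_ge0//.
(* If u_j > 2 t with t = C1 2^-(m+1) L, then w_j > t, so the number of such j is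
   at most t^-1 times the sum of w. *)
have cnt m : \sum_j (2 ^- m.+1 < v j)%R%:R <= C2 / C1 * (2 `^ s) ^+ m.+1.
  have [w [w0 uw sw]] := hw m.+1.
  have tm0 : 0 < C1 * 2 ^- m.+1 * L by rewrite !mulr_gt0 ?invr_gt0 ?exprn_gt0.
  have : \sum_j (2 ^- m.+1 < v j)%R%:R * (C1 * 2 ^- m.+1 * L) <= \sum_j w j.
    apply: ler_sum => j _; case: ltP => h; last by rewrite mul0r w0.
    rewrite mul1r; move: h; rewrite /v ltr_pdivlMr// => h.
    have := uw j; lra.
  rewrite -mulr_suml => /le_trans/(_ sw); rewrite -ler_pdivlMr// => h.
  apply: (le_trans h); rewrite le_eqVlt; apply/orP; left; apply/eqP.
  have -> : 2 `^ s = 2 * 2 `^ (s - 1) :> R.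
    by rewrite -[X in X * _]powRr1// -powRD ?subrKC// pnatr_eq0 implybT.
  rewrite !invfM invrK [in RHS]exprMn.
  rewrite (_ : C2 * _ * L * _ = C2 / C1 * (2 ^+ m.+1 * (2 `^ (s - 1)) ^+ m.+1) * (L * L^-1)); last by lra.
  by rewrite mulfV ?mulr1// gt_eqF.
set K := C2 / C1 * 2 `^ s.
have K0 : 0 <= K by rewrite !mulr_ge0 ?invr_ge0 ?powR_ge0// ltW.
set x := 2 `^ (- (r - s)).
have x01 : 0 <= x < 1.
  rewrite powR_ge0/= /x powRN invf_lt1 ?powR_gt0//.
  have e1 : 1 = 1 `^ (r - s) :> R by rewrite powR1.
  by rewrite [ltLHS]e1 gt0_ltr_powR ?nnegrE ?subr_gt0//; lra.
have bound M : \sum_j v j `^ r <= J%:R * (2 `^ (- r)) ^+ M + K * (1 - x)^-1.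
  apply: (@le_trans _ _ (\sum_(j < J) (\sum_(m < M) (2 `^ (- r)) ^+ m * (2 ^- m.+1 < v j)%R%:R + (2 `^ (- r)) ^+ M))).
    by apply: ler_sum => j _; apply: powR_level_sum => //; lra.
  rewrite big_split/= addrC sumr_const card_ord -[X in X + _]mulr_natl lerD2l exchange_big/=.
  apply: (@le_trans _ _ (\sum_(m < M) K * x ^+ m)); last first.
    by rewrite -mulr_sumr ler_wpM2l//; exact: sum_geometric_le.
  apply: ler_sum => m _; rewrite -mulr_sumr.
  apply: (@le_trans _ _ ((2 `^ (- r)) ^+ m * (C2 / C1 * (2 `^ s) ^+ m.+1))).
    by rewrite ler_wpM2l// exprn_ge0// powR_ge0.
  rewrite exprS /K /x (_ : - (r - s) = - r + s); last by lra.
  rewrite powRD ?exprMn; last by rewrite pnatr_eq0 implybT.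
  by rewrite le_eqVlt; apply/orP; left; apply/eqP; lra.
(* The remainder of the level sums is at most J 2^-M; M = J makes it at most 1. *)
have [M hM] : exists M, J%:R * (2 `^ (- r)) ^+ M <= 1 :> R.
  exists J; apply: (@le_trans _ _ (J%:R * 2^-1 ^+ J)).
    rewrite ler_wpM2l// lerXn2r ?nnegrE ?powR_ge0// powRN lef_pV2 ?posrE ?powR_gt0//.
    by rewrite -[leLHS]powRr1// ler_powR//; lra.
  rewrite exprVn ler_pdivrMr ?exprn_gt0// mul1r -natrX ler_nat ltnW//; exact: ltn_expl.
by apply: (le_trans (bound M)); lra.
Qed.

End sequences.

Section lorentz.
Context {R : realType} {n : nat}.
Local Notation mu := (@lebesgue_rV R n).
Implicit Types (g : 'rV[R]_n -> \bar R).

Lemma rearrangement_ge0 g t : (0 <= rearrangement g t)%E.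
Proof. by apply: le_ereal_inf_tmp => _ [y /= [y0 _] <-]; rewrite lee_fin. Qed.

Lemma rearrangement_le g t (y : R) : 0 <= y ->
  (mu [set x | y%:E < `|g x|] <= t%:E)%E -> (rearrangement g t <= y%:E)%E.
Proof. by move=> y0 h; apply: ereal_inf_lbound; exists y. Qed.

Lemma dyadic_bracket (G : R) : 0 < G ->
  exists i : nat, 2 ^+ i < G <= 2 * 2 ^+ i \/ 2 ^- i.+1 < G <= 2 * 2 ^- i.+1.
Proof.
move=> G0; have up (x : R) : exists k, x <= 2 ^+ k.
  exists (truncn x).+1; rewrite (le_trans (ltW (truncnS_gt _)))// -natrX ler_nat ltnW//.
  exact: ltn_expl.
have [G1|G1] := ltP 1 G.
  have [k hk kmin] := ex_minnP (up G).
  case: k hk kmin => [|k] hk kmin; first by move: hk; rewrite expr0 leNgt G1.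
  exists k; left; rewrite -exprS hk andbT ltNge; apply/negP => /kmin.
  by rewrite ltnn.
have ex : exists k, 2 ^- k < G.
  have [k hk] := up (G^-1); exists k.+1; rewrite invf_plt ?posrE ?exprn_gt0//.
  by rewrite (le_lt_trans hk)// exprS ltr_pMl ?exprn_gt0//; lra.
have [k hk kmin] := ex_minnP ex.
case: k hk kmin => [|k] hk kmin; first by move: hk; rewrite expr0 invr1 ltNge G1.
exists k; right; rewrite hk/= exprS invfM mulrA mulfV ?mul1r// leNgt.
by apply/negP => /kmin; rewrite ltnn.
Qed.

(** The integral is cut according to the dyadic size of the rearrangement G =
    g^*(t).  If y < G <= 2 y then t < D, where D is the measure of the set
    where |g| > y, so (t G)^r / t <= (2 y)^r D^(r-1), which integrates over
    ]0, D[ to 2^r (y D)^r. *)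
Lemma lorentz1_norm_le g (r S C : R) : 1 <= r -> 0 <= S -> 0 <= C ->
  measurable_fun setT g ->
  (forall y : R, 0 < y -> (y%:E * mu [set x | y%:E < `|g x|] <= C%:E)%E) ->
  (forall (y : R) J, 0 < y ->
     \sum_(j < J) (2 ^+ j * y * fine (mu [set x | (2 ^+ j * y)%:E < `|g x|]%E)) `^ r <= S) ->
  (lorentz1_norm r%:E g <= (2 * S `^ r^-1)%:E)%E.
Proof.
move=> r1 S0 C0 mg hC hS; rewrite /lorentz1_norm.
have r0 : 0 < r by lra.
pose D (y : R) := fine (mu [set x | (y%:E < `|g x|)%E]).
have mD (y : R) : measurable [set x | (y%:E < `|g x|)%E].
  rewrite -[X in measurable X]setTI; apply: emeasurable_fun_o_infty => //.
  exact: measurableT_comp.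
have Dfin y : 0 < y -> mu [set x | (y%:E < `|g x|)%E] = (D y)%:E.
  move=> y0; rewrite /D fineK// ge0_fin_numE//; have := hC y y0.
  by case: (mu _) => [d| |]//; [move=> _; rewrite ltry|rewrite gt0_muley ?lte_fin// leye_eq].
have D0 y : 0 <= D y by exact: fine_ge0.
have rt y t : 0 < y -> (y%:E < rearrangement g t)%E -> t < D y.
  move=> y0; apply: contraTlt => tD; rewrite -leNgt.
  by apply: rearrangement_le; [exact: ltW|rewrite Dfin// lee_fin].
pose h y (t : R) : \bar R := (((2 * y) `^ r * D y `^ (r - 1))%:E * (\1_(`]0, D y[) t)%:E)%E.
have h0 y t : (0 <= h y t)%E by rewrite mule_ge0// lee_fin// mulr_ge0// powR_ge0.
have mh y : measurable_fun setT (h y).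
  by apply: measurable_funeM; apply/measurable_EFinP; apply: measurable_indic.
have ih y : 0 < y -> (\int[lebesgue_measure]_(t in `]0%R, +oo[) h y t <= (2 `^ r * (y * D y) `^ r)%:E)%E.
  move=> y0; rewrite ge0_integralZl_EFin//; last 2 first.
  - by apply/measurable_EFinP; apply: measurable_indic.
  - by rewrite mulr_ge0// powR_ge0.
  rewrite integral_indic//.
  apply: (@le_trans _ _ (((2 * y) `^ r * D y `^ (r - 1))%:E * (D y)%:E)%E).
    apply: lee_wpmul2l; first by rewrite lee_fin mulr_ge0// powR_ge0.
    apply: (@le_trans _ _ (lebesgue_measure (`]0, D y[ : set R))).
      by apply: le_measure; rewrite ?inE//; exact: measurableI.
    by rewrite lebesgue_measure_itv/= lte_fin; case: ifP; rewrite ?EFinN ?sube0// lee_fin.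
  rewrite -EFinM lee_fin -mulrA.
  have -> : D y `^ (r - 1) * D y = D y `^ r.
    have [->|Dy] := eqVneq (D y) 0; first by rewrite mulr0 powR0// gt_eqF.
    by rewrite -[X in _ * X]powRr1// -powRD ?subrK// Dy implybT.
  by rewrite !powRM ?(ltW y0)// mulrA.
(* The levels y range over the powers of 2 with exponents i and -(i+1). *)
have F1 t : 0 < t -> ((t%:E * rearrangement g t) `^ r * (t^-1)%:E <=
    \sum_(0 <= i <oo) (h (2 ^+ i)%R t + h (2 ^- i.+1)%R t))%E.
  move=> t0; have : (rearrangement g t <= (C / t)%:E)%E.
    have Ct : 0 <= C / t by rewrite divr_ge0// ltW.
    apply/lee_addgt0Pr => e e0; rewrite -EFinD; apply: rearrangement_le; first by lra.
    have ce0 : 0 < C / t + e by lra.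
    rewrite Dfin// lee_fin; have := hC _ ce0; rewrite Dfin// -EFinM lee_fin.
    have : t * (C / t + e) >= C by rewrite mulrDr mulrCA mulfV ?gt_eqF// mulr1 lerDl mulr_ge0// ltW.
    by move=> h1 h2; rewrite -(ler_pM2l ce0) (le_trans h2)// mulrC.
  have := rt; have := rearrangement_ge0 g t.
  case E : (rearrangement g t) => [G| |]// G0 rtG _.
  have G0' : 0 <= G by [].
  have s0 i : (0 <= h (2 ^+ i)%R t + h (2 ^- i.+1)%R t)%E by rewrite adde_ge0.
  move: G0'; rewrite le_eqVlt => /predU1P[<-|Gp].
    by rewrite mule0 poweR_EFin powR0 ?gt_eqF// mul0e nneseries_ge0.
  have key y : 0 < y -> y < G <= 2 * y ->
      (((t%:E * G%:E) `^ r * (t^-1)%:E)%E <= h y t)%E.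
    move=> y0 /andP[yG Gy]; have tD : t < D y by apply: rtG => //; rewrite E lte_fin.
    rewrite -(EFinM t G) poweR_EFin -EFinM /h indicE mem_set ?mule1; last by rewrite /= in_itv/= t0 tD.
    rewrite lee_fin [(t * G) `^ r]powRM ?(ltW t0)//.
    have -> : t `^ r * G `^ r / t = G `^ r * t `^ (r - 1).
      have -> : t `^ r = t `^ (r - 1) * t.
        by rewrite -[X in _ = _ * X]powRr1 ?(ltW t0)// -powRD ?subrK// gt_eqF ?implybT.
      rewrite (_ : _ / t = G `^ r * t `^ (r - 1) * (t * t^-1)); last by lra.
      by rewrite mulfV ?mulr1// gt_eqF.
    apply: ler_pM; rewrite ?powR_ge0//.
      by rewrite ge0_ler_powR ?nnegrE//; lra.
    by rewrite ge0_ler_powR ?nnegrE//; lra.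
  have [i hi] := dyadic_bracket Gp.
  apply: (@le_trans _ _ (h (2 ^+ i)%R t + h (2 ^- i.+1)%R t)%E).
    case: hi => /key; rewrite ?invr_gt0 ?exprn_gt0// => /(_ isT) hi.
      by apply: (le_trans hi); rewrite leeDl.
    by apply: (le_trans hi); rewrite leeDr.
  apply: (@le_trans _ _ (\sum_(0 <= j < i.+1) (h (2 ^+ j)%R t + h (2 ^- j.+1)%R t))%E).
    by rewrite big_nat_recr//= leeDr// sume_ge0.
  exact: nneseries_lim_ge.
set I := (X in (X `^ _)%E).
have IS : (I <= (2 `^ r * S)%:E)%E.
  apply: (@le_trans _ _ (\int[lebesgue_measure]_(t in `]0%R, +oo[)
      \sum_(0 <= i <oo) (h (2 ^+ i)%R t + h (2 ^- i.+1)%R t))%E).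
    apply: ge0_integral_mono => t /=; rewrite in_itv/= andbT => t0; last exact: F1.
    by rewrite mule_ge0 ?poweR_ge0// lee_fin invr_ge0 ltW.
  rewrite integral_nneseries//; last 2 first.
  - by move=> i; apply: measurable_funTS; apply: emeasurable_funD; exact: mh.
  - by move=> i t _; rewrite adde_ge0.
  apply: nneseries_le => [i|J]; first by apply: integral_ge0 => t _; rewrite adde_ge0.
  apply: (@le_trans _ _ (\sum_(i < J) ((2 `^ r * (2 ^+ i * D (2 ^+ i)) `^ r)%R%:E +
       (2 `^ r * (2 ^- i.+1 * D (2 ^- i.+1)) `^ r)%R%:E))%E).
    apply: lee_sum => i _; rewrite ge0_integralD//; [|exact: (measurable_funTS (mh _))..].
    by apply: leeD; apply: ih; rewrite ?invr_gt0 exprn_gt0.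
  under eq_bigr do rewrite -EFinD -mulrDr.
  rewrite sumEFin lee_fin -mulr_sumr ler_wpM2l ?powR_ge0//.
  have yJ : 0 < 2 ^- J :> R by rewrite invr_gt0 exprn_gt0.
  apply: le_trans (hS _ (J + J)%N yJ).
  rewrite big_split_ord/= big_split/= addrC lerD// le_eqVlt; apply/orP; left; apply/eqP.
    rewrite (reindex_inj rev_ord_inj)/=; apply: eq_bigr => i _.
    have -> : 2 ^- (J - i.+1).+1 = 2 ^+ i * 2 ^- J :> R; last by [].
    rewrite subnSK//; have iJ : (i <= J)%N by rewrite ltnW.
    have -> : 2 ^+ J = 2 ^+ (J - i) * 2 ^+ i :> R by rewrite -exprD subnK.
    by rewrite invfM mulrCA mulfV ?mulr1// expf_neq0.
  apply: eq_bigr => i _.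
  by have -> : 2 ^+ (J + i) * 2 ^- J = 2 ^+ i :> R by rewrite exprD mulrAC mulfV ?mul1r// expf_neq0.
have I0 : (0 <= I)%E.
  apply: integral_ge0 => t /=; rewrite in_itv/= andbT => t0.
  by rewrite mule_ge0 ?poweR_ge0// lee_fin invr_ge0 ltW.
case: I IS I0 => [I| |//] IS I0; last by rewrite leye_eq in IS.
rewrite poweR_EFin lee_fin.
have -> : 2 * S `^ r^-1 = (2 `^ r * S) `^ r^-1.
  by rewrite powRM ?powR_ge0// -powRrM mulfV ?gt_eqF// powRr1.
by rewrite ge0_ler_powR ?nnegrE ?invr_ge0 ?(ltW r0)// mulr_ge0 ?powR_ge0.
Qed.

Lemma lorentz1_norm_pinfty_le g (C : R) : 0 <= C ->
  (forall y : R, 0 < y -> (y%:E * mu [set x | y%:E < `|g x|] <= C%:E)%E) ->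
  (lorentz1_norm +oo%E g <= C%:E)%E.
Proof.
move=> C0 hC; apply: ge_ereal_sup => _ [t /= + <-]; rewrite in_itv/= andbT => t0.
have Ct : 0 <= C / t by rewrite divr_ge0// ltW.
have : (rearrangement g t <= (C / t)%:E)%E.
  apply/lee_addgt0Pr => e e0; rewrite -EFinD; apply: rearrangement_le; first by lra.
  have ce0 : 0 < C / t + e by lra.
  have := hC _ ce0; rewrite muleC -lee_pdivlMr// => /le_trans; apply.
  by rewrite lee_fin ler_pdivrMr// mulrDr mulrCA mulfV ?gt_eqF// mulr1 lerDl mulr_ge0// ltW.
move=> h; apply: (@le_trans _ _ (t%:E * (C / t)%:E)%E).
  by apply: lee_wpmul2l h; rewrite lee_fin ltW.
by rewrite -EFinM mulrCA mulfV ?mulr1// gt_eqF.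
Qed.

End lorentz.

(** * Splitting an atomic decomposition *)

Section splitting.
Context {R : realType} {n : nat}.
Local Notation mu := (@lebesgue_rV R n).
Implicit Types (x y z : 'rV[R]_n) (phi f : 'rV[R]_n -> R).
Implicit Types (lam : R^nat) (a : nat -> 'rV[R]_n -> R).

(** Convolution with a fixed bounded kernel is continuous for the L^1 norm, so
    the bound passes from the partial sums to f. *)
Lemma normr_convolve_series_le phi f lam a t y (K : \bar R) : schwartz phi ->
  mu.-integrable setT (EFin \o f) ->
  (forall j, mu.-integrable setT (EFin \o a j)) ->
  ('N[mu]_1[(fun x => (f x - \sum_(0 <= j < N) lam j * a j x)%R%:E)]%E
        @[N --> \oo] --> 0%E) ->
  (forall N, (\sum_(j < N) (`|lam j|%:E * `|convolve (distribution_of (a j)) (dilate phi t) y|%:E) <= K)%E) ->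
  (`|convolve (distribution_of f) (dilate phi t) y|%:E <= K)%E.
Proof.
move=> sphi intf ia cvN hK.
have [M M0 hM] := dilate_bounded t y sphi; have mg := measurable_dilate t y sphi.
set psi := fun z => dilate phi t (y - z) in mg hM.
pose S N z := \sum_(0 <= j < N) lam j * a j z.
have iS N : mu.-integrable setT (EFin \o S N).
  have -> : EFin \o S N = (fun z => \sum_(j <- iota 0 N) (lam j * a j z)%:E)%E.
    by apply/funext => z; rewrite /= /S sumEFin /index_iota subn0.
  apply: integrable_sum => // j _.
  by have := integrableZl measurableT (lam j) (ia j).
have cS N : `|\int[mu]_z (S N z * psi z)| <=
    \sum_(j < N) `|lam j| * `|convolve (distribution_of (a j)) (dilate phi t) y|.
  have -> : \int[mu]_z (S N z * psi z) = \sum_(j < N) lam j * \int[mu]_z (a j z * psi z).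
    elim: N => [|N ih].
      rewrite big_ord0; under eq_Rintegral do rewrite /S big_geq// mul0r.
      by rewrite /Rintegral integral0.
    rewrite big_ord_recr/= -ih.
    have E z : S N.+1 z * psi z = S N z * psi z + lam N * (a N z * psi z).
      by rewrite /S big_nat_recr//= mulrDl mulrA.
    have iap := integrable_mul_bounded (ia N) mg hM.
    transitivity (\int[mu]_z (S N z * psi z + lam N * (a N z * psi z))).
      by apply: eq_Rintegral => z _; exact: E.
    rewrite RintegralD//.
    - by rewrite RintegralZl.
    - exact: (integrable_mul_bounded (iS N) mg hM).
    - by have := integrableZl measurableT (lam N) iap.
  apply: (le_trans (ler_norm_sum _ _ _)); apply: ler_sum => j _.
  by rewrite normrM.
apply/lee_addgt0Pr => e e0.
have M1 : 0 < M + 1 by lra.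
have [N hN] : exists N, ('N[mu]_1[(fun x => (f x - S N x)%R%:E)] < (e / (M + 1))%:E)%E.
  have e1 : (0 < (e / (M + 1))%:E)%E by rewrite lte_fin divr_gt0.
  have := cvN [set u | (u < (e / (M + 1))%:E)%E].
  case; first by apply: open_nbhs_nbhs; split => //; exact: open_ereal_lt_ereal.
  by move=> N _ h; exists N; apply: (h N) => /=.
have ifS : mu.-integrable setT (EFin \o (fun z => f z - S N z)).
  by have := integrableB measurableT intf (iS N).
have mfS : measurable_fun setT (fun z => f z - S N z).
  by move/integrableP : ifS => [/measurable_EFinP].
have -> : convolve (distribution_of f) (dilate phi t) y =
    \int[mu]_z ((f z - S N z) * psi z) + \int[mu]_z (S N z * psi z).
  rewrite -RintegralD//; last 2 first.
  - exact: (integrable_mul_bounded ifS mg hM).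
  - exact: (integrable_mul_bounded (iS N) mg hM).
  by apply: eq_Rintegral => z _; rewrite -mulrDl subrK.
apply: (@le_trans _ _ (`|\int[mu]_z ((f z - S N z) * psi z)|%:E + `|\int[mu]_z (S N z * psi z)|%:E)%E).
  by rewrite -EFinD lee_fin ler_normD.
rewrite addeC; apply: leeD.
  apply: le_trans (hK N); under eq_bigr do rewrite -EFinM.
  by rewrite sumEFin lee_fin.
apply: (le_trans (normr_Rintegral_le _ _)); first exact: measurable_funM.
apply: (@le_trans _ _ (M%:E * (e / (M + 1))%:E)%E); last first.
  rewrite -EFinM lee_fin mulrA ler_pdivrMr// mulrC ler_wpM2l//; lra.
apply: (@le_trans _ _ (M%:E * \int[mu]_z `|f z - S N z|%:E)%E).
  rewrite -ge0_integralZl_EFin//; last first.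
    by apply/measurable_EFinP; exact: measurableT_comp.
  apply: ge0_integral_mono => z _; first by rewrite lee_fin.
  by rewrite -EFinM lee_fin normrM mulrC ler_wpM2r//; exact: hM.
apply: lee_wpmul2l => //; apply/ltW; apply: le_lt_trans hN.
by rewrite Lnorm1.
Qed.

(** Atoms with p_j > P enter a majorant B in L^1 and are estimated through
    [hlmax], whose weak (1,1) inequality does not see the number of atoms;
    atoms with p_j <= P enter G = sum_j |lam_j| N a_j, whose integral is
    summable because integrals, unlike weak norms, add up.  The clause P < 2
    is there since every p_j is at least 2: it gives the plain weak (1,1)
    bound on N f. *)
Lemma nontangential_max_split phi (s : R) : schwartz phi -> 1 < s ->
  exists C1 C2 : R, [/\ 0 < C1, 0 <= C2 &
  forall f lam a (L : R), mu.-integrable setT (EFin \o f) ->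
    atomic_decomposition s%:E f lam a ->
    (\sum_(0 <= j <oo) `|lam j|%:E <= L%:E)%E ->
    forall P : R, 1 <= P -> exists G : 'rV[R]_n -> \bar R,
    [/\ measurable_fun setT G, forall x, (0 <= G x)%E,
        (P < 2 -> forall x, G x = 0%E),
        (\int[mu]_x G x <= (C2 * P `^ (1 - s^-1) * L)%:E)%E &
        forall y : R, 0 < y ->
        (y%:E * mu [set x | y%:E < nontangential_max phi (distribution_of f) x]
          <= (C1 * P `^ (- s^-1) * L)%:E + y%:E * mu [set x | (y / 2)%:E < G x])%E]].
Proof.
move=> sphi s1; have s0 : 0 < s by lra.
have si : s^-1 < 1 by rewrite invf_lt1.
have si0 : 0 < s^-1 by rewrite invr_gt0.
have [C0 C00 hC0] := integral_dilate_le sphi.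
have [C2 C20 hC2] := integral_atom_nontangential sphi.
(* The factor C0 + 1 is positive, so that levels can be divided by it. *)
pose C0' := C0 + 1; have C0'0 : 0 < C0' by rewrite /C0'; lra.
exists (2 * C0' * 6 ^+ n * 2), C2; split => //; first by rewrite !mulr_gt0 ?exprn_gt0.
move=> f lam a L intf [ata lamoo cvN] lamL P P1.
have /choice[d hd] : forall j, exists d : (R * R) * ('rV[R]_n * R),
    [/\ 1 < d.1.2, d.1.2 <= 2, d.1.1^-1 + d.1.2^-1 = 1, 0 < d.2.2 &
        is_atom_on d.1.1 d.1.2 s%:E (cube d.2.1 d.2.2) (a j)].
  by move=> j; have [p [q [x0 [l h]]]] := ata j; exists ((p, q), (x0, l)).
pose p j := (d j).1.1.
have p2 j : 2 <= p j by have [h1 h2 h3 _ _] := hd j; exact: conjugate_ge2 h3.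
have ma j : measurable_fun setT (a j) by have [_ _ _ _ []] := hd j.
have a1 j : (\int[mu]_z `|a j z|%:E <= (2 * p j `^ (- s^-1))%:E)%E.
  by have [h1 h2 h3 h4 h5] := hd j; exact: atom_L1 h5 s0.
have aN j : (\int[mu]_x nontangential_max phi (distribution_of (a j)) x <=
      (C2 * (p j * p j `^ (- s^-1)))%:E)%E.
  by have [h1 h2 h3 h4 h5] := hd j; exact: hC2 h5.
have ia j : mu.-integrable setT (EFin \o a j).
  by apply: integrable_of_lt_pinfty => //; apply: le_lt_trans (a1 j) _; rewrite ltry.
pose N j := nontangential_max phi (distribution_of (a j)).
have mN j : measurable_fun setT (N j) by exact: measurable_nontangential_max.
have N0 j x : (0 <= N j x)%E by exact: nontangential_max_ge0.
pose wG j : R := if p j <= P then `|lam j| else 0.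
pose wB j : R := if p j <= P then 0 else `|lam j|.
have wG0 j : 0 <= wG j by rewrite /wG; case: ifP.
have wB0 j : 0 <= wB j by rewrite /wB; case: ifP.
pose tG j x := ((wG j)%:E * N j x)%E.
pose tB j x := ((wB j)%:E * `|a j x|%:E)%E.
have tG0 j x : (0 <= tG j x)%E by rewrite mule_ge0// lee_fin.
have tB0 j x : (0 <= tB j x)%E by rewrite mule_ge0// lee_fin.
have mna j : measurable_fun setT (fun z => `|a j z|%:E).
  by apply/measurable_EFinP; exact: measurableT_comp.
have mtG j : measurable_fun setT (tG j) by exact: measurable_funeM.
have mtB j : measurable_fun setT (tB j) by exact: measurable_funeM.
pose G x := (\sum_(0 <= j <oo) tG j x)%E.
pose B x := (\sum_(0 <= j <oo) tB j x)%E.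
have G0 x : (0 <= G x)%E by apply: nneseries_ge0.
have B0 x : (0 <= B x)%E by apply: nneseries_ge0.
have mG : measurable_fun setT G by apply: ge0_emeasurable_sum => // j x _ _; exact: tG0.
have mB : measurable_fun setT B by apply: ge0_emeasurable_sum => // j x _ _; exact: tB0.
have partial_lam K (c : R) : 0 <= c -> (\sum_(j < K) (c * `|lam j|)%:E <= (c * L)%:E)%E.
  move=> c0; rewrite sumEFin -mulr_sumr lee_fin ler_wpM2l// -lee_fin -sumEFin.
  apply: le_trans lamL; rewrite -(big_mkord xpredT (fun j => `|lam j|%:E)).
  exact: nneseries_lim_ge.
have intG : (\int[mu]_x G x <= (C2 * P `^ (1 - s^-1) * L)%:E)%E.
  rewrite integral_nneseries//; apply: nneseries_le => [j|K]; first exact: integral_ge0.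
  have PP : 0 <= C2 * P `^ (1 - s^-1) by rewrite mulr_ge0// powR_ge0.
  apply: le_trans (partial_lam K _ PP); apply: lee_sum => j _.
  rewrite ge0_integralZl_EFin//.
  apply: (@le_trans _ _ ((wG j)%:E * (C2 * (p j * p j `^ (- s^-1)))%:E)%E).
    by apply: lee_wpmul2l; [rewrite lee_fin|exact: aN].
  rewrite -EFinM lee_fin /wG; have := p2 j; case: ifP => pP pj2; last by rewrite mul0r mulr_ge0.
  rewrite mulrC ler_wpM2r// ler_wpM2l//.
  have -> : p j * p j `^ (- s^-1) = p j `^ (1 - s^-1).
    rewrite -[X in X * _]powRr1 ?powRD//; last by lra.
    by apply/implyP => _; rewrite gt_eqF//; lra.
  by rewrite ge0_ler_powR ?nnegrE//; lra.
have intB : (\int[mu]_x B x <= (2 * P `^ (- s^-1) * L)%:E)%E.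
  rewrite integral_nneseries//; apply: nneseries_le => [j|K]; first exact: integral_ge0.
  have PP : 0 <= 2 * P `^ (- s^-1) by rewrite mulr_ge0// powR_ge0.
  apply: le_trans (partial_lam K _ PP); apply: lee_sum => j _.
  rewrite ge0_integralZl_EFin//.
  apply: (@le_trans _ _ ((wB j)%:E * (2 * p j `^ (- s^-1))%:E)%E).
    by apply: lee_wpmul2l; [rewrite lee_fin|exact: a1].
  rewrite -EFinM lee_fin /wB; have pj2 := p2 j; have [pP|pP] := leP (p j) P; first by rewrite mul0r mulr_ge0.
  rewrite mulrC ler_wpM2r// ler_wpM2l// !powRN lef_pV2 ?posrE ?powR_gt0//; try lra.
  by rewrite ge0_ler_powR ?nnegrE//; lra.
have pointwise x : (nontangential_max phi (distribution_of f) x <= C0'%:E * hlmax B x + G x)%E.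
  apply: ge_ereal_sup => _ [[y t] /= xyt <-].
  have xyt' : `|x - y| < t by rewrite (le_lt_trans (normr_le_euclidean _)).
  have t0 : 0 < t by rewrite (le_lt_trans _ xyt').
  apply: (normr_convolve_series_le sphi intf ia cvN) => K.
  apply: (@le_trans _ _ (\sum_(j < K) (\int[mu]_z (tB j z * `|dilate phi t (y - z)|%:E) + tG j x))%E).
    apply: lee_sum => j _; rewrite /tB /tG /wB /wG; case: ifP => _.
      under eq_integral do rewrite mul0e mul0e.
      rewrite integral0 add0e; apply: lee_wpmul2l => //.
      by apply: ereal_sup_ubound; exists (y, t).
    rewrite mul0e adde0; under eq_integral do rewrite -muleA.
    rewrite ge0_integralZl_EFin//.
    - by apply: lee_wpmul2l => //; exact: convolve_le.
    - apply: emeasurable_funM => //; apply/measurable_EFinP.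
      by apply: measurableT_comp => //; exact: measurable_dilate.
  rewrite big_split/=; apply: leeD; last first.
    rewrite -(big_mkord xpredT (fun j => tG j x)); exact: nneseries_lim_ge.
  apply: (@le_trans _ _ (C0%:E * hlmax B x)%E); last first.
    by apply: lee_wpmul2r; [exact: hlmax_ge0|rewrite lee_fin /C0'; lra].
  apply: le_trans (hC0 B x y t B0 mB t0 xyt').
  rewrite -ge0_integral_sum//; last 2 first.
  - move=> j; apply: emeasurable_funM => //; apply/measurable_EFinP.
    by apply: measurableT_comp => //; exact: measurable_dilate.
  - by move=> j z _; rewrite mule_ge0// lee_fin.
  apply: ge0_integral_mono => z _; first by apply: sume_ge0 => j _; rewrite mule_ge0// lee_fin.
  rewrite -ge0_sume_distrl//; apply: lee_wpmul2r => //.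
  rewrite -(big_mkord xpredT (fun j => tB j z)); exact: nneseries_lim_ge.
exists G; split => //.
  move=> P2 x; rewrite /G; apply: eseries0 => j _ _.
  by rewrite /tG /wG leNgt (lt_le_trans P2 (p2 j))/= mul0e.
move=> y y0.
have l0 : 0 < y / 2 / C0' by rewrite !divr_gt0.
have mM : measurable [set x | ((y / 2 / C0')%:E < hlmax B x)%E].
  by apply: open_measurable_rV; exact: hlmax_lsc.
have mGy : measurable [set x | ((y / 2)%:E < G x)%E].
  by rewrite -[X in measurable X]setTI; exact: emeasurable_fun_o_infty.
have sub : [set x | (y%:E < nontangential_max phi (distribution_of f) x)%E] `<=`
    [set x | ((y / 2 / C0')%:E < hlmax B x)%E] `|` [set x | ((y / 2)%:E < G x)%E].
  move=> x /= yx; have {}yx := lt_le_trans yx (pointwise x).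
  have [h1|h1] := ltP ((y / 2 / C0')%:E) (hlmax B x); first by left.
  right; rewrite ltNge; apply/negP => h2.
  move: yx; rewrite ltNge => /negP; apply.
  apply: (@le_trans _ _ (C0'%:E * (y / 2 / C0')%:E + (y / 2)%:E)%E).
    by apply: leeD => //; apply: lee_wpmul2l => //; rewrite lee_fin ltW.
  by rewrite -EFinM -EFinD lee_fin [C0' * _]mulrC divfK ?gt_eqF//; lra.
have mle : (mu [set x | (y%:E < nontangential_max phi (distribution_of f) x)%E] <=
   mu [set x | ((y / 2 / C0')%:E < hlmax B x)%E] + mu [set x | ((y / 2)%:E < G x)%E])%E.
  apply: le_trans (measureU2 mu mM mGy); apply: le_measure; rewrite ?inE//.
    by apply: open_measurable_rV; exact: nontangential_max_lsc.
  exact: measurableU.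
apply: (le_trans (lee_wpmul2l _ mle)); first by rewrite lee_fin ltW.
rewrite ge0_muleDr//; apply: leeD => //.
have W := hlmax_weak11 B0 mB l0.
have {}W := le_trans W (lee_wpmul2l _ intB).
have {}W := W ltac:(by rewrite lee_fin exprn_ge0).
pose m := mu [set x | ((y / 2 / C0')%:E < hlmax B x)%E].
have -> : (y%:E * m = (2 * C0')%:E * ((y / 2 / C0')%:E * m))%E.
  rewrite muleA -EFinM; congr (_%:E * _)%E.
  rewrite (_ : 2 * C0' * _ = y * (C0' * C0'^-1)); last by lra.
  by rewrite mulfV ?mulr1// gt_eqF.
apply: (le_trans (lee_wpmul2l _ W)); first by rewrite lee_fin mulr_ge0// ltW.
by rewrite -!EFinM lee_fin le_eqVlt; apply/orP; left; apply/eqP; lra.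
Qed.

End splitting.

(** * The norm estimate *)

Section constants.
Context {R : realType}.

Lemma powR_exprn (b x : R) m : 0 <= b -> (b ^+ m) `^ x = (b `^ x) ^+ m.
Proof.
move=> b0; elim: m => [|m ih]; first by rewrite !expr0 powR1.
by rewrite !exprS powRM ?exprn_ge0// ih.
Qed.

(** For r - s <= 1 this is [exp2_gap] and 1/s - 1/r = (r - s) / (r s) <= r -
    s; for r - s > 1 the sum of the geometric series is at most 2 and the gap
    1/s - 1/r is less than 1. *)
Lemma geometric_gap (s r : R) : 1 < s -> s < r ->
  1 <= (1 - 2 `^ (- (r - s)))^-1 <= 3 / (s^-1 - r^-1).
Proof.
move=> s1 sr; set x := 2 `^ (- (r - s)).
have s0 : s != 0 by rewrite gt_eqF//; lra.
have r0 : r != 0 by rewrite gt_eqF//; lra.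
have rs : 1 < r * s by nra.
have eE : s^-1 - r^-1 = (r - s) / (r * s).
  have h1 : r * r^-1 = 1 by rewrite mulfV.
  have h2 : s * s^-1 = 1 by rewrite mulfV.
  rewrite invfM (_ : (r - s) * (r^-1 * s^-1) = r * r^-1 * s^-1 - s * s^-1 * r^-1).
    by rewrite h1 h2 !mul1r.
  by lra.
have e0 : 0 < s^-1 - r^-1 by rewrite eE divr_gt0//; lra.
have e1 : s^-1 - r^-1 < 1.
  have : s^-1 < 1 by rewrite invf_lt1//; lra.
  have : 0 < r^-1 by rewrite invr_gt0; lra.
  by lra.
have ex : s^-1 - r^-1 <= r - s by rewrite eE ler_pdivrMr; nra.
have x0 : 0 < x by rewrite powR_gt0.
suff h : (s^-1 - r^-1) / 3 <= 1 - x.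
  have hx : 0 < 1 - x by apply: lt_le_trans h; rewrite divr_gt0.
  rewrite -[3 / _]invf_div lef_pV2 ?posrE// ?divr_gt0// h andbT.
  by rewrite invf_ge1//; lra.
have [rs1|rs1] := leP (r - s) 1.
  have := @exp2_gap R (r - s) ltac:(lra); rewrite -/x; lra.
have : x <= 2^-1; last by lra.
rewrite /x powRN lef_pV2 ?posrE ?powR_gt0// -[leLHS]powRr1// ler_powR; lra.
Qed.

End constants.

Section hardy_lorentz.
Context {R : realType} {n : nat}.
Local Notation mu := (@lebesgue_rV R n).
Implicit Types (x y z : 'rV[R]_n) (phi psi f : 'rV[R]_n -> R).

(** The pairing with psi is bounded by the L^1 norm of f times the sup norm of
    psi, which is the seminorm of index zero. *)
Lemma tempered_distribution_of f : mu.-integrable setT (EFin \o f) ->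
  tempered (distribution_of f).
Proof.
move=> intf.
have mf : measurable_fun setT f by move/integrableP : intf => [/measurable_EFinP].
have mpsi psi : schwartz psi -> measurable_fun setT psi.
  by move=> /schwartz_continuous; exact: continuous_measurable_rV.
split.
  move=> c psi1 psi2 s1 s2.
  have [M1 _ h1] := schwartz_bounded s1; have [M2 _ h2] := schwartz_bounded s2.
  have i1 := integrable_mul_bounded intf (mpsi _ s1) h1.
  have i2 := integrable_mul_bounded intf (mpsi _ s2) h2.
  rewrite /distribution_of -RintegralZl// -RintegralD//.
    by apply: eq_Rintegral => x _; lra.
  by have := integrableZl measurableT c i1.
have fin : (\int[mu]_x `|f x|%:E)%E \is a fin_num.
  rewrite ge0_fin_numE; last by apply: integral_ge0 => x _; rewrite lee_fin.
  by move/integrableP : intf => [_].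
exists (fine (\int[mu]_x `|f x|%:E)%E), [:: ((fun=> 0%N), [::])] => psi spsi.
rewrite big_seq1/= fineK//.
have [c c0 hc] := schwartz_seminorm_bound (fun=> 0%N) [::] spsi.
set q := schwartz_seminorm _ _ _.
have hq x : (`|psi x|%:E <= q)%E.
  apply: ereal_sup_ubound; exists x => //; rewrite /monomial.
  by under eq_bigr do rewrite expr0; rewrite big1_eq mul1r.
have q0 : (0 <= q)%E by apply: le_trans (hq 0); rewrite lee_fin.
have qf : q \is a fin_num by rewrite ge0_fin_numE//; exact: spsi.2.
apply: (le_trans (normr_Rintegral_le _ _)).
  by apply: measurable_funM => //; exact: mpsi.
rewrite -(fineK qf) muleC -ge0_integralZl_EFin//; last 2 first.
- by apply/measurable_EFinP; exact: measurableT_comp.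
- exact: fine_ge0.
apply: ge0_integral_mono => x _; first by rewrite lee_fin.
rewrite -EFinM lee_fin normrM mulrC ler_wpM2r//.
by rewrite -lee_fin fineK.
Qed.

(** The split at P = 2^(ms) feeds [real_interpolation_sum], whose output feeds
    [lorentz1_norm_le].  As 1 + K z >= 1 and 1/r <= 1, the rth root can be
    dropped. *)
Lemma hardy_lorentz_norm_decomposition phi (s : R) : schwartz phi -> 1 < s ->
  exists2 c : R, 0 < c &
  forall f lam a (L : R) (r : \bar R), mu.-integrable setT (EFin \o f) ->
    atomic_decomposition s%:E f lam a -> 0 < L ->
    (\sum_(0 <= j <oo) `|lam j|%:E <= L%:E)%E -> (s%:E < r)%E ->
    (hardy_lorentz_norm phi r (distribution_of f) <=
      (c / (s^-1 - fine (r^-1)%E) * L)%:E)%E.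
Proof.
move=> sphi s1.
have [C1 [C2 [C10 C20 hsplit]]] := nontangential_max_split sphi s1.
pose K := (4 * C2) / C1 * 2 `^ s.
have K0 : 0 <= K by rewrite !mulr_ge0 ?invr_ge0 ?powR_ge0// ltW.
have s0 : s != 0 by rewrite gt_eqF//; lra.
have si0 : 0 < s^-1 by rewrite invr_gt0; lra.
exists (12 * C1 * (1 + K)) => [|f lam a L r intf dec L0 lamL sr].
  by rewrite !mulr_gt0//; lra.
set N := nontangential_max phi (distribution_of f).
have mN : measurable_fun setT N by exact: measurable_nontangential_max.
have N0 x : (0 <= N x)%E by exact: nontangential_max_ge0.
have NE (y : R) : [set x | (y%:E < `|N x|)%E] = [set x | (y%:E < N x)%E].
  by apply/seteqP; split => x /=; rewrite gee0_abs.
have W1 (y : R) : 0 < y -> (y%:E * mu [set x | y%:E < `|N x|] <= (C1 * L)%:E)%E.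
  move=> y0; rewrite NE.
  have [G [mG G0 Gz intG h]] := hsplit f lam a L intf dec lamL 1 (lexx _).
  apply: (le_trans (h y y0)); rewrite powR1 mulr1.
  rewrite (_ : [set x | ((y / 2)%:E < G x)%E] = set0) ?measure0 ?mule0 ?adde0//.
  apply/seteqP; split => x //=; rewrite Gz ?ltr1n// lte_fin; lra.
have CL0 : 0 <= C1 * L by rewrite mulr_ge0// ltW.
case: r sr => [r| |//] sr; last first.
  apply: (le_trans (lorentz1_norm_pinfty_le CL0 W1)).
  rewrite invey/= subr0 invrK lee_fin ler_wpM2r ?(ltW L0)//.
  have : C1 * 1 <= C1 * (12 * (1 + K) * s).
    by rewrite ler_wpM2l ?(ltW C10)//; nra.
  by lra.
rewrite lte_fin in sr.
have r1 : 1 < r by lra.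
have r0 : r != 0 by rewrite gt_eqF//; lra.
have -> : fine (r%:E^-1)%E = r^-1 by rewrite inver (negbTE r0).
have /andP[z1 z3] := geometric_gap s1 sr.
set z := (1 - _)^-1 in z1 z3.
pose S := (2 * C1 * L) `^ r * (1 + K * z).
have Kz0 : 0 <= K * z by rewrite mulr_ge0//; lra.
have S0 : 0 <= S by rewrite mulr_ge0 ?powR_ge0//; lra.
have W2 (y : R) J : 0 < y ->
   \sum_(j < J) (2 ^+ j * y * fine (mu [set x | (2 ^+ j * y)%:E < `|N x|]%E)) `^ r <= S.
  move=> y0; apply: real_interpolation_sum => //.
  - by rewrite mulr_ge0.
  - move=> j; have yj0 : 0 < 2 ^+ j * y by rewrite mulr_gt0 ?exprn_gt0.
    have := W1 _ yj0; have m0 : (0 <= mu [set x | ((2 ^+ j * y)%:E < `|N x|)%E])%E by [].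
    rewrite mulr_ge0 ?fine_ge0 ?(ltW yj0)//=.
    case: (mu _) m0 => [d| |]//= _.
    by rewrite mulr0.
  move=> m; pose P : R := (2 `^ s) ^+ m.
  have P1 : 1 <= P.
    rewrite /P exprn_ege1//; have e1 : 1 = 2 `^ 0 :> R by rewrite powRr0.
    by rewrite [leLHS]e1 ler_powR//; lra.
  have Pm (x : R) : P `^ x = (2 `^ (s * x)) ^+ m.
    by rewrite /P powR_exprn ?powR_ge0// powRrM.
  have [G [mG G0 _ intG h]] := hsplit f lam a L intf dec lamL P P1.
  have y20 : 0 < y / 2 by rewrite divr_gt0.
  pose e (j : nat) := (mu [set x | (2 ^+ j * (y / 2))%:E < G x])%E.
  have e0 j : (0 <= e j)%E by [].
  have yj0 (j : nat) : 0 < 2 ^+ j * y by rewrite mulr_gt0 ?exprn_gt0.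
  have ey (j : nat) : ((2 ^+ j * y)%:E * e j = 2%:E * ((2 ^+ j * (y / 2))%:E * e j))%E.
    by rewrite muleA -EFinM; congr (_%:E * _)%E; lra.
  have se : (\sum_(j < J) (2 ^+ j * y)%:E * e j <= (4 * C2 * (2 `^ (s - 1)) ^+ m * L)%:E)%E.
    under eq_bigr do rewrite ey.
    rewrite -ge0_sume_distrr; last by move=> j _; rewrite mule_ge0// lee_fin mulr_ge0 ?exprn_ge0// ltW.
    apply: (@le_trans _ _ (2%:E * (2%:E * \int[mu]_x G x))%E).
      by apply: lee_wpmul2l; [rewrite lee_fin|exact: dyadic_sum_le_integral].
    apply: (@le_trans _ _ (2%:E * (2%:E * (C2 * P `^ (1 - s^-1) * L)%:E))%E).
      by do 2 (apply: lee_wpmul2l; first by rewrite lee_fin).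
    rewrite -!EFinM lee_fin Pm mulrBr mulr1 mulfV//; lra.
  have efin (j : 'I_J) : e j \is a fin_num.
    rewrite ge0_fin_numE// ltey; apply/eqP => ej; move: se.
    rewrite (bigD1 j)//= ej gt0_muley ?lte_fin// addye ?leye_eq//.
    rewrite -ltNye; apply: (@lt_le_trans _ _ 0%E); first exact: ltNyr.
    by apply: sume_ge0 => i _; rewrite mule_ge0// lee_fin ltW.
  exists (fun j => 2 ^+ j * y * fine (e j)); split.
  - by move=> j; rewrite mulr_ge0 ?fine_ge0// ltW.
  - move=> j; have := h _ (yj0 j).
    have -> : P `^ (- s^-1) = 2 ^- m by rewrite Pm mulrN mulfV// powR_inv1// exprVn.
    have -> : 2 ^+ j * y / 2 = 2 ^+ j * (y / 2) by lra.
    rewrite -/(e j) => hj.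
    have {}hj : ((2 ^+ j * y)%:E * mu [set x | ((2 ^+ j * y)%:E < `|N x|)%E] <=
        (C1 * 2 ^- m * L)%:E + (2 ^+ j * y)%:E * e j)%E by rewrite NE.
    have Wj := W1 _ (yj0 j).
    have m0 : (0 <= mu [set x | ((2 ^+ j * y)%:E < `|N x|)%E])%E by [].
    move: Wj hj; rewrite -(fineK (efin j)) -EFinM -EFinD.
    case: (mu _) m0 => [d| |]//= _.
    by rewrite mulr0 => _ _; rewrite addr_ge0// ?mulr_ge0 ?fine_ge0 ?invr_ge0 ?exprn_ge0// ltW.
  - rewrite -lee_fin -sumEFin; apply: le_trans se; apply: lee_sum => j _.
    by rewrite EFinM fineK.
apply: (le_trans (lorentz1_norm_le (ltW r1) S0 CL0 mN W1 W2)).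
rewrite lee_fin.
have -> : S `^ r^-1 = 2 * C1 * L * (1 + K * z) `^ r^-1.
  rewrite powRM ?powR_ge0//; last by lra.
  by rewrite -powRrM mulfV// powRr1// mulr_ge0 ?mulr_ge0// ltW.
have zr : (1 + K * z) `^ r^-1 <= (1 + K) * z.
  apply: (@le_trans _ _ (1 + K * z)); last by nra.
  by apply: ler1_powR; [lra|rewrite invf_le1; lra].
apply: (@le_trans _ _ (2 * (2 * C1 * L * ((1 + K) * (3 / (s^-1 - r^-1)))))).
  rewrite ler_wpM2l// ler_wpM2l ?mulr_ge0 ?(ltW C10) ?(ltW L0)//.
  by apply: (le_trans zr); rewrite ler_wpM2l//; lra.
by rewrite le_eqVlt; apply/orP; left; apply/eqP; lra.
Qed.

End hardy_lorentz.

Theorem proposition2p2 (R : realType) (n : nat) (hn : (0 < n)%N)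
    (phi : 'rV[R]_n -> R) (hphi : schwartz phi)
    (hphi0 : \int[lebesgue_rV n]_x phi x != 0)
    (s : R) (hs : 1 < s) :
  exists (c : R) (c_ : \bar R -> R),
    (forall r : \bar R, (s%:E < r)%E ->
       0 <= c_ r /\ c_ r <= c / (s^-1 - fine (r^-1)%E)) /\
    (forall (f : 'rV[R]_n -> R) (r : \bar R),
       Xspace s%:E f -> (s%:E < r)%E ->
       hardy_lorentz phi r (distribution_of f) /\
       (hardy_lorentz_norm phi r (distribution_of f)
          <= (c_ r)%:E * Xnorm s%:E f)%E).
Proof.
have [c c0 hc] := hardy_lorentz_norm_decomposition hphi hs.
have gap (r : \bar R) : (s%:E < r)%E -> 0 < s^-1 - fine (r^-1)%E.
  have s0 : 0 < s by lra.
  case: r => [r| |//]; last by rewrite invey/= subr0 invr_gt0.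
  rewrite lte_fin => sr; rewrite inver gt_eqF; last by lra.
  by rewrite /= subr_gt0 ltf_pV2 ?posrE//; lra.
exists c, (fun r => c / (s^-1 - fine (r^-1)%E)); split.
  by move=> r /gap g; split => //; rewrite divr_ge0// ltW.
move=> f r [intf [lam0 [a0 dec0]]] sr.
have cr0 : 0 < c / (s^-1 - fine (r^-1)%E) by rewrite divr_gt0// gap.
set cr := c / _ in cr0 *.
have bound lam a : atomic_decomposition s%:E f lam a ->
    (hardy_lorentz_norm phi r (distribution_of f) <=
      cr%:E * \sum_(0 <= j <oo) `|lam j|%:E)%E.
  move=> dec; have [_ lamoo _] := dec.
  have l0 : (0 <= \sum_(0 <= j <oo) `|lam j|%:E)%E.
    by apply: nneseries_ge0 => j _ _; rewrite lee_fin.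
  have lfin : (\sum_(0 <= j <oo) `|lam j|%:E)%E \is a fin_num by rewrite ge0_fin_numE.
  rewrite -(fineK lfin) -EFinM; apply/lee_addgt0Pr => e e0.
  have L0 : 0 < fine (\sum_(0 <= j <oo) `|lam j|%:E)%E + e / cr.
    by rewrite ltr_wpDl ?fine_ge0// divr_gt0.
  have lamL : (\sum_(0 <= j <oo) `|lam j|%:E <=
      (fine (\sum_(0 <= j <oo) `|lam j|%:E)%E + e / cr)%:E)%E.
    by rewrite EFinD fineK// leeDl// lee_fin divr_ge0// ltW.
  apply: (le_trans (hc f lam a _ r intf dec L0 lamL sr)).
  by rewrite -/cr mulrDr mulrCA mulfV ?mulr1 ?EFinD// gt_eqF.
have nb : (hardy_lorentz_norm phi r (distribution_of f) < +oo)%E.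
  apply: (le_lt_trans (bound _ _ dec0)); have [_ lamoo _] := dec0.
  by rewrite lte_mul_pinfty// lee_fin ltW.
split; last first.
  rewrite -lee_pdivrMl//; apply: le_ereal_inf_tmp => _ [lam [a [dec ->]]].
  by rewrite lee_pdivrMl//; exact: bound dec.
split; first exact: tempered_distribution_of.
by split => //; exact: measurable_nontangential_max.
Qed.
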